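(* In the setting described in the context, let $F\in V^*$ and $\widehat F$ on $V+V_{\mathrm{nc}}$ be given by $$F(v):=\int_\Omega G:D^m v\,dx+\int_\Omega g v\,dx+\sum_{a\in A}\beta(a)v(a)\quad(v\in V),$$ $$\widehat F(\widehat v):=\int_\Omega G:D^m_{\mathrm{pw}}\widehat v\,dx+\int_\Omega g\widehat v\,dx+\sum_{a\in A}\beta(a)\widehat v(a)\quad(\widehat v\in V+V_{\mathrm{nc}}),$$ with $G\in L^2(\Omega;\mathbb R^{2^m})$, $g\in L^2(\Omega)$, a finite set $A$ of interior vertices of $\mathcal T$, and $\beta(a)\in\mathbb R$ for $a\in A$. Let $u\in V$ solve $a(u,v)=F(v)$ for all $v\in V$ and let $u_{\mathrm{nc}}\in V_{\mathrm{nc}}$ solve $a_{\mathrm{pw}}(u_{\mathrm{nc}},v_{\mathrm{nc}})=\widehat F(v_{\mathrm{nc}})$ for all $v_{\mathrm{nc}}\in V_{\mathrm{nc}}$. Then (a) $\displaystyle |\!|\!| u-Ju_{\mathrm{nc}}|\!|\!|^2+|\!|\!| I_{\mathrm{nc}}u-u_{\mathrm{nc}}|\!|\!|_{\mathrm{pw}}^2\le\left(\|G-\Pi_0G\|+\kappa_m\|h_{\mathcal T}^mg\|+|\!|\!| u_{\mathrm{nc}}-Ju_{\mathrm{nc}}|\!|\!|_{\mathrm{pw}}\right)^2,$ (b) $\displaystyle |\!|\!| u-u_{\mathrm{nc}}|\!|\!|_{\mathrm{pw}}^2+|\!|\!| I_{\mathrm{nc}}u-u_{\mathrm{nc}}|\!|\!|_{\mathrm{pw}}^2\le\left(\|G-\Pi_0G\|+\kappa_m\|h_{\mathcal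 T}^mg\|+|\!|\!| u_{\mathrm{nc}}-Ju_{\mathrm{nc}}|\!|\!|_{\mathrm{pw}}\right)^2+2\widehat F(u_{\mathrm{nc}}-Ju_{\mathrm{nc}}).$
   Context: Let $m\in\mathbb N$ (the paper's examples are Crouzeix–Raviart, $m=1$, and Morley, $m=2$), let $\Omega\subset\mathbb R^2$ be a planar bounded Lipschitz domain with polygonal boundary, $V:=H^m_0(\Omega)$, $V^*=H^{-m}(\Omega)$, $a(v,w):=\int_\Omega D^m v:D^m w\,dx$ for $v,w\in V$, and $|\!|\!| v|\!|\!|:=a(v,v)^{1/2}$. Write $\|\cdot\|:=\|\cdot\|_{L^2(\Omega)}$. Let $\mathcal T$ be a shape-regular triangulation of $\Omega$ into triangles, $P_k(\mathcal T)$ the space of piecewise polynomials of total degree at most $k$, $\Pi_k$ the $L^2$ projection onto $P_k(\mathcal T)$ (componentwise for tensor fields), $H^m(\mathcal T):=\{v\in L^2(\Omega): v|_T\in H^m(T)\ \forall T\in\mathcal T\}$, $D^m_{\mathrm{pw}}$ the piecewise $m$-th derivative, and $h_{\mathcal T}\in P_0(\mathcal T)$ with $h_{\mathcal T}|_T=\mathrm{diam}(T)$. Set $a_{\mathrm{pw}}(v,w):=\int_\Omega D^m_{\mathrm{pw}}v:D^m_{\mathrm{pw}}w\,dx$ for $v,w\in H^m(\mathcal T)$ and $|\!|\!| v|\!|\!|_{\mathrm{pw}}:=a_{\mathrm{pw}}(v,v)^{1/2}$. $V_{\mathrm{nc}}\subset P_m(\mathcal T)$ is a nontrivial linear subspace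 on which $|\!|\!|\cdot|\!|\!|_{\mathrm{pw}}$ is a norm. There are an interpolation operator $I_{\mathrm{nc}}:V\to V_{\mathrm{nc}}$ and a constant $\kappa_m>0$ with, for all $v\in V$ and $w_m\in P_m(\mathcal T)$: $a_{\mathrm{pw}}(v-I_{\mathrm{nc}}v,w_m)=0$; $\|h_{\mathcal T}^{-m}(v-I_{\mathrm{nc}}v)\|\le\kappa_m|\!|\!| v-I_{\mathrm{nc}}v|\!|\!|_{\mathrm{pw}}$; and $D^m_{\mathrm{pw}}(v-I_{\mathrm{nc}}v)$ is $L^2$-orthogonal to $P_0(\mathcal T;\mathbb R^{2^m})$. There are a linear operator $J:V_{\mathrm{nc}}\to V$ and a constant $\Lambda_{\mathrm J}$ such that for all $v_{\mathrm{nc}}\in V_{\mathrm{nc}}$ and $v\in V$: $I_{\mathrm{nc}}Jv_{\mathrm{nc}}=v_{\mathrm{nc}}$; $|\!|\!| v_{\mathrm{nc}}-Jv_{\mathrm{nc}}|\!|\!|_{\mathrm{pw}}\le\Lambda_{\mathrm J}|\!|\!| v_{\mathrm{nc}}-v|\!|\!|_{\mathrm{pw}}$; and $v_{\mathrm{nc}}-Jv_{\mathrm{nc}}$ is $L^2(\Omega)$-orthogonal to $P_m(\mathcal T)$. Point forces: $A=\emptyset$ if $m=1$. If $A\ne\emptyset$ (so $m\ge2$ and point evaluation is bounded on $V$), all functions in $V_{\mathrm{nc}}$ are continuous at the interior vertices of $\mathcal T$ and $(I_{\mathrm{nc}}v)(a)=v(a)$ for all $v\in V$ and all $a\in A$ (as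 for the Morley element). *)

(* Defs.v *)
From HB Require Import structures.
From mathcomp Require Import all_boot all_order all_algebra.
From mathcomp Require Import all_classical all_reals all_analysis.

Set Implicit Arguments.
Unset Strict Implicit.
Unset Printing Implicit Defensive.
Import Order.TTheory GRing.Theory Num.Theory.
Import numFieldNormedType.Exports.

Local Open Scope classical_set_scope.
Local Open Scope ring_scope.

(* Functions on [R * R] stand for (classes of) functions on a planar set [U];
   their values outside [U] are irrelevant, and equality in L^2(U) is [ae_eq_on]. *)

Section Plane.
Variable R : realType.

Local Notation mu2 := (@lebesgue_measure R \x @lebesgue_measure R)%E.

Definition ae_eq_on (U : set (R * R)) (f g : R * R -> R) : Prop :=
  {ae mu2, forall x, U x -> f x = g x}.

(* The norm of the product type [R * R] is the maximum norm. *)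
Definition enorm (x : R * R) : R := Num.sqrt (x.1 ^+ 2 + x.2 ^+ 2).

Definition eball (c : R * R) (r : R) : set (R * R) := [set x | enorm (x - c) < r].

Definition diam (K : set (R * R)) : R :=
  sup [set d | exists x y, [/\ K x, K y & d = enorm (x - y)]].

Definition frontier (U : set (R * R)) : set (R * R) := closure U `\` U°.

Definition segment (p q : R * R) : set (R * R) :=
  [set x | exists2 t : R, 0 <= t <= 1 & x = (1 - t) *: p + t *: q].

(* Near each boundary point x, in the orthonormal frame (c, s), (-s, c) centred
   at x, the set is the strict epigraph of a Lipschitz function. *)
Definition lipschitz_boundary (U : set (R * R)) : Prop :=
  forall x, frontier U x ->
  exists (c s k r h : R) (gamma : R -> R),
    [/\ c ^+ 2 + s ^+ 2 = 1, 0 < r, 0 < h,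
        forall t t' : R, `|gamma t - gamma t'| <= k * `|t - t'|
      & forall t y : R, `|t| < r -> `|y| < h ->
          U (x + t *: (c, s) + y *: (- s, c)) <-> gamma t < y].

Definition polygonal_boundary (U : set (R * R)) : Prop :=
  exists n (p q : 'I_n -> R * R), frontier U = \bigcup_i segment (p i) (q i).

Definition polygonal_lipschitz_domain (U : set (R * R)) : Prop :=
  [/\ open U, connected U, U !=set0, bounded_set U
    & lipschitz_boundary U /\ polygonal_boundary U].

(* The closed face of the triangle with vertices [p] spanned by the vertices
   with index in [S]; it is empty for [S = finset.set0]. *)
Definition face (p : 'I_3 -> R * R) (S : {set 'I_3}) : set (R * R) :=
  [set x | exists l : 'I_3 -> R,
    [/\ forall k, 0 <= l k, forall k, k \notin S -> l k = 0,
        \sum_k l k = 1 & x = \sum_k l k *: p k]].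

Definition tri (p : 'I_3 -> R * R) : set (R * R) := face p [set: 'I_3]%SET.

Definition nondegenerate (p : 'I_3 -> R * R) : Prop :=
  let d := p (inord 1) - p (inord 0) in
  let e := p (inord 2) - p (inord 0) in
  d.1 * e.2 - d.2 * e.1 != 0.

(* Conforming triangulations: two distinct triangles are disjoint or share
   exactly a common vertex or a common edge. *)
Definition triangulation (U : set (R * R)) N (T : 'I_N -> 'I_3 -> R * R) : Prop :=
  [/\ forall i, nondegenerate (T i),
      closure U = \bigcup_i tri (T i)
    & forall i j, i != j -> exists S S' : {set 'I_3},
        [/\ S != [set: 'I_3]%SET, S' != [set: 'I_3]%SET,
            tri (T i) `&` tri (T j) = face (T i) S & face (T i) S = face (T j) S']].

Definition shape_regular (sigma : R) N (T : 'I_N -> 'I_3 -> R * R) : Prop :=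
  forall i, exists c r,
    [/\ 0 < r, eball c r `<=` tri (T i) & diam (tri (T i)) <= sigma * r].

Definition interior_vertex (U : set (R * R)) N (T : 'I_N -> 'I_3 -> R * R)
    (z : R * R) : Prop :=
  U z /\ exists i k, z = T i k.

(* The piecewise constant mesh size; it vanishes on the (null) skeleton. *)
Definition meshsize N (T : 'I_N -> 'I_3 -> R * R) (x : R * R) : R :=
  \sum_i diam (tri (T i)) * \1_((tri (T i))°) x.

Definition inL2 (U : set (R * R)) (f : R * R -> R) : Prop :=
  (f \_ U) \in Lfun mu2 2%:E.

Definition int2 (U : set (R * R)) (f : R * R -> R) : R :=
  \int[mu2]_(x in U) f x.

Definition l2norm (U : set (R * R)) (f : R * R -> R) : R :=
  Num.sqrt (int2 U (fun x => f x ^+ 2)).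

Definition edir (i : 'I_2) : R * R := if i == ord0 then (1, 0) else (0, 1).

Definition pderiv (s : seq 'I_2) (f : R * R -> R) : R * R -> R :=
  foldr (fun i g => 'D_(edir i) g) f s.

Definition smooth (f : R * R -> R) : Prop :=
  forall s, continuous (pderiv s f) /\
    forall i x, derivable (pderiv s f) x (edir i).

Definition test_function (U : set (R * R)) (f : R * R -> R) : Prop :=
  smooth f /\ exists K, [/\ compact K, K `<=` U & forall x, ~ K x -> f x = 0].

Definition is_weak_derivative (U : set (R * R)) (s : seq 'I_2)
    (v w : R * R -> R) : Prop :=
  forall f, test_function U f ->
    int2 U (fun x => v x * pderiv s f x) = (-1) ^+ size s * int2 U (fun x => w x * f x).

(* [wderiv U s v] is a representative of the weak derivative of [v] on [U] in L^2
   (unique up to null sets), and 0 if there is none. *)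
Definition wderiv (U : set (R * R)) (s : seq 'I_2) (v : R * R -> R) : R * R -> R :=
  xget (fun=> 0) [set w | inL2 U w /\ is_weak_derivative U s v w].

Definition sobolev m (U : set (R * R)) : set (R * R -> R) :=
  [set v | inL2 U v /\ forall s, (size s <= m)%N ->
     exists w, inL2 U w /\ is_weak_derivative U s v w].

(* The closure of the test functions in H^m(U). For m >= 2, the elements of
   H^m_0(U) are identified with their continuous representatives (Sobolev
   embedding in the plane), so that v(a) is the value of the function v at a. *)
Definition sobolev0 m (U : set (R * R)) : set (R * R -> R) :=
  [set v | [/\ sobolev m U v,
     exists f : nat -> R * R -> R, (forall n, test_function U (f n)) /\
       forall s, (size s <= m)%N ->
         l2norm U (wderiv U s v - pderiv s (f n)) @[n --> \oo] --> 0
   & (2 <= m)%N -> forall x, U x -> {for x, continuous v}]].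

(* Tensor fields with values in R^(2^m). *)
Definition tensor m := m.-tuple 'I_2 -> R * R -> R.

Definition tdot m (U : set (R * R)) (G H : tensor m) : R :=
  int2 U (fun x => \sum_al G al x * H al x).

Definition tnorm m (U : set (R * R)) (G : tensor m) : R := Num.sqrt (tdot U G G).

Definition Dm m (U : set (R * R)) (v : R * R -> R) : tensor m :=
  fun al => wderiv U al v.

(* The piecewise weak derivative, taken on each open triangle; it is 0 on the
   (null) skeleton. *)
Definition Dpw m N (T : 'I_N -> 'I_3 -> R * R) (v : R * R -> R) : tensor m :=
  fun al x => \sum_i (wderiv (tri (T i))° al v \_ (tri (T i))°) x.

Definition poly2 k (c : nat -> nat -> R) (x : R * R) : R :=
  \sum_(i < k.+1) \sum_(j < k.+1 | (i + j <= k)%N) c i j * x.1 ^+ i * x.2 ^+ j.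

Definition pwpoly k (U : set (R * R)) N (T : 'I_N -> 'I_3 -> R * R) :
    set (R * R -> R) :=
  [set v | measurable_fun U v /\
    forall i, exists c, forall x, (tri (T i))° x -> v x = poly2 k c x].

Definition l2proj k (U : set (R * R)) N (T : 'I_N -> 'I_3 -> R * R)
    (f : R * R -> R) : R * R -> R :=
  xget (fun=> 0) [set q | pwpoly k U T q /\
    forall p, pwpoly k U T p -> int2 U (fun x => (f x - q x) * p x) = 0].

Definition tproj k m (U : set (R * R)) N (T : 'I_N -> 'I_3 -> R * R)
    (G : tensor m) : tensor m := fun al => l2proj k U T (G al).

Definition afun m (U : set (R * R)) (v w : R * R -> R) : R :=
  tdot U (Dm U v : tensor m) (Dm U w).

Definition energy m (U : set (R * R)) (v : R * R -> R) : R :=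
  Num.sqrt (afun m U v v).

Definition apw m (U : set (R * R)) N (T : 'I_N -> 'I_3 -> R * R)
    (v w : R * R -> R) : R := tdot U (Dpw T v : tensor m) (Dpw T w).

Definition energy_pw m (U : set (R * R)) N (T : 'I_N -> 'I_3 -> R * R)
    (v : R * R -> R) : R := Num.sqrt (apw m U T v v).

Definition lincomb (a : R) (v w : R * R -> R) : R * R -> R :=
  fun x => a * v x + w x.

Definition linear_subspace (W : set (R * R -> R)) : Prop :=
  W (fun=> 0) /\ forall a v w, W v -> W w -> W (lincomb a v w).

Definition is_norm_on (U : set (R * R)) (W : set (R * R -> R))
    (nrm : (R * R -> R) -> R) : Prop :=
  [/\ forall v, W v -> 0 <= nrm v,
      forall v, W v -> nrm v = 0 -> ae_eq_on U v (fun=> 0),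
      forall (a : R) v, W v -> nrm (fun x => a * v x) = `|a| * nrm v
    & forall v w, W v -> W w -> nrm (v + w) <= nrm v + nrm w].

(* Bounded linear functionals on the subspace [W] normed by [nrm]. *)
Definition in_dual (W : set (R * R -> R)) (nrm : (R * R -> R) -> R)
    (F : (R * R -> R) -> R) : Prop :=
  (forall a v w, W v -> W w -> F (lincomb a v w) = a * F v + F w) /\
  exists C, forall v, W v -> `|F v| <= C * nrm v.

Definition sumspace (V W : set (R * R -> R)) : set (R * R -> R) :=
  [set v | exists v1 v2, [/\ V v1, W v2 & v = v1 + v2]].

End Plane.

(* Main.v *)
Require Import Defs.
From HB Require Import structures.
From mathcomp Require Import all_boot all_order all_algebra.
From mathcomp Require Import all_classical all_reals all_analysis measurable_realfun.
From mathcomp Require Import ring lra.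

(** The estimates are two Hilbert space identities followed by a completion of
    the square.  Write [B] for the broken energy product [apw], [L] for the
    part [v |-> int (G : D^m v + g v)] of the load ([load] below), [I] for
    [Inc], [d := unc - J unc] and [w := I u - unc].

    For [v] in [V], the remainder [v - I v] is [B]-orthogonal to piecewise
    polynomials; since [I (J unc) = unc], the same holds for [d].  The point
    forces do not see [v - I v], because [I] preserves the values at the points
    of [A].  Testing both discrete and continuous equations therefore gives:

    - with [e := u - J unc] and [r := e - I e],
      [B e e = B r r + B w w] and [B e e = L r + B d r];
    - with [z := u - unc] and [r := u - I u],
      [B z z = B r r + B w w] and [B z z = L r + Fhat d - B r d].

    These are [conforming_error_identity] and [nonconforming_error_identity],
    stated for abstract bilinear data.  In the first one [I] is not known to be
    linear, but [I e] and [w] have the same energy because they have the same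
    [B]-products with [Vnc].  As [D^m r] has vanishing means on the triangles
    and [r] is small in the weighted norm,
    [L r <= (|G - P0 G| + kappa |h^m g|) |r|] ([load_oscillation]), and
    [|B d r| <= |d| |r|].  So [|r|^2 + |w|^2 <= est |r| + c], and completing
    the square gives [|r|^2 + 2 |w|^2 <= est^2 + 2 c] ([square_completion]).

    Most of the file makes the function spaces behave.  Since [wderiv] selects
    one representative of a weak derivative, linearity of [v |-> D^m v] and
    agreement of global and piecewise derivatives hold only almost everywhere,
    and both rest on the uniqueness of weak derivatives.  This is the
    fundamental lemma of the calculus of variations, [ae0_test_function]:
    products of smooth plateau functions converge to indicators of open boxes,
    and integrals over boxes determine an integrable function.  Piecewise
    polynomials have weak derivatives on each triangle by integration by parts
    ([weakly_smooth_poly2]).  The geometry enters twice: almost every point of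
    the domain lies in the interior of one triangle and in no other triangle
    ([ae_triangulation]), and the open triangles are
    contained in the domain because a Lipschitz domain lies locally on one
    side of its boundary ([tri_sub_domain]). *)

Set Implicit Arguments.
Unset Strict Implicit.
Unset Printing Implicit Defensive.
Import Order.TTheory GRing.Theory Num.Theory.
Import numFieldNormedType.Exports.

Local Open Scope classical_set_scope.
Local Open Scope ring_scope.

(** * Smooth plateau functions on the line *)

Section SmoothLine.
Variable R : realType.
Implicit Types (f g : R -> R) (n k : nat).

Fixpoint ntimes_diff n f : Prop :=
  if n is n'.+1 then
    exists2 df : R -> R, forall x : R, is_derive x 1 f (df x) & ntimes_diff n' df
  else continuous f.

Lemma ntimes_diff_continuous n f : ntimes_diff n f -> continuous f.
Proof.
case: n => [//|n] [df fdf _] x; apply: differentiable_continuous.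
by apply/derivable1_diffP; have [] := fdf x.
Qed.

Lemma ntimes_diffW n f : ntimes_diff n.+1 f -> ntimes_diff n f.
Proof.
elim: n f => [|n ih] f; first exact: ntimes_diff_continuous.
by case=> df fdf /ih dfn; exists df.
Qed.

Lemma ntimes_diff_cst n (c : R) : ntimes_diff n (cst c).
Proof.
elim: n c => [|n ih] c; first by move=> x; exact: cst_continuous.
by exists (cst 0) => // x; exact: is_derive_cst.
Qed.

Lemma ntimes_diffD n f g :
  ntimes_diff n f -> ntimes_diff n g -> ntimes_diff n (f \+ g).
Proof.
elim: n f g => [|n ih] f g.
  by move=> cf cg x; apply: continuousD; [exact: cf|exact: cg].
case=> df fdf dfn [dg gdg dgn]; exists (df \+ dg); last exact: ih.
by move=> x; apply: is_deriveD.
Qed.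

Lemma ntimes_diffM n f g :
  ntimes_diff n f -> ntimes_diff n g -> ntimes_diff n (f \* g).
Proof.
elim: n f g => [|n ih] f g.
  by move=> cf cg x; apply: continuousM; [exact: cf|exact: cg].
move=> hf hg; have [df fdf dfn] := hf; have [dg gdg dgn] := hg.
exists ((f \* dg) \+ (g \* df)).
  by move=> x; apply: is_deriveM.
by apply: ntimes_diffD; apply: ih => //; exact: ntimes_diffW.
Qed.

Lemma ntimes_diffX n f k : ntimes_diff n f -> ntimes_diff n (fun x => f x ^+ k).
Proof.
move=> hf; elim: k => [|k ih].
  by under eq_fun do rewrite expr0; exact: ntimes_diff_cst.
by under eq_fun do rewrite exprS; exact: ntimes_diffM.
Qed.

Lemma ntimes_diff_affine n f (a b : R) :
  ntimes_diff n f -> ntimes_diff n (fun x => f (a * x + b)).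
Proof.
elim: n f => [|n ih] f hf.
  move=> x; apply: (@continuous_comp _ _ _ (fun y => a * y + b) f).
    apply: continuousD; last exact: cst_continuous.
    by apply: continuousM; [exact: cst_continuous|exact: cvg_id].
  exact: hf.
case: hf => df fdf dfn; exists (fun x => a * df (a * x + b)); last first.
  by apply: (@ntimes_diffM n (cst a)); [exact: ntimes_diff_cst|exact: ih].
move=> x; have h : is_derive x 1 (fun y => a * y + b) a.
  have h := is_deriveD (is_deriveM (is_derive_cst a x 1) (is_derive_id x 1))
     (is_derive_cst b x 1).
  by apply: (is_derive_eq h); rewrite scaler0 !addr0 /GRing.scale/= mulr1.
by rewrite mulrC; exact: (@is_derive1_comp _ f (fun y => a * y + b)).
Qed.

(** The functions whose iterated derivatives at 0 all vanish; the family is, up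
    to linear combinations, closed under derivation, so that a single induction
    shows that each of them is smooth. *)
Definition flat k (t : R) : R :=
  if 0 < t then t^-1 ^+ k * expR (- t^-1) else 0.

(** The exponential series dominates each of its terms: at [1/t] the term of
    order [k+1] gives the linear bound that makes the difference quotient of
    [flat k.-1] at 0 tend to 0. *)
Lemma flat_le k (t : R) : 0 <= t -> 0 <= flat k t <= (k.+1)`!%:R * t.
Proof.
move=> t0; rewrite /flat; case: ifPn => [tpos|_]; last first.
  by rewrite lexx mulr_ge0.
rewrite mulr_ge0 ?exprn_ge0 ?invr_ge0 ?expR_ge0//=.
have tV : 0 <= t^-1 by rewrite invr_ge0.
have := expR_ge1Dxn k tV; rewrite expRN => h.
have F0 : 0 < (k.+1)`!%:R :> R by rewrite ltr0n fact_gt0.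
rewrite ler_pdivrMr ?expR_gt0// mulrAC -mulrA mulrC.
have -> : t^-1 ^+ k = (t^-1 ^+ k.+1 / (k.+1)`!%:R) * (t * (k.+1)`!%:R).
  by rewrite exprSr; field; rewrite !gt_eqF.
rewrite -[leRHS]mulrA ler_wpM2r ?mulr_ge0//.
by apply: le_trans h; rewrite lerDr.
Qed.

Lemma is_derive_flat k (x : R) :
  is_derive x 1 (flat k) (- k%:R * flat k.+1 x + flat k.+2 x).
Proof.
have [x0|x0|->] := ltgtP x 0.
- have -> : - k%:R * flat k.+1 x + flat k.+2 x = 0.
    by rewrite /flat ltNge (ltW x0)/= mulr0 addr0.
  apply: (@near_eq_is_derive _ _ _ (cst 0)).
  near=> y; rewrite /flat /= ifF//; apply/negbTE; rewrite -leNgt ltW//.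
  by near: y; exact: lt_nbhsl.
- apply: (@near_eq_is_derive _ _ _ (fun t : R => t^-1 ^+ k * expR (- t^-1))).
  + near=> y; rewrite /flat ifT//.
    by near: y; exact: lt_nbhsr.
  + have x0' : x != 0 by rewrite gt_eqF.
    have hV : is_derive x 1 (fun t : R => t^-1) (- x ^- 2).
      by apply: is_derive_eq; [exact: is_deriveV|rewrite /GRing.scale /= mulr1].
    have hN : is_derive x 1 (fun t : R => - t^-1) (x ^- 2).
      by apply: (is_derive_eq (is_deriveN hV)); rewrite opprK.
    have hE : is_derive x 1 (expR \o (fun t : R => - t^-1))
        (expR (- x^-1) * x ^- 2) by exact: is_derive1_comp.
    have hX := @is_deriveX _ _ (fun t : R => t^-1) k x 1 _ hV.
    have -> : (fun t : R => t^-1 ^+ k * expR (- t^-1)) =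
        (fun t : R => t^-1) ^+ k * (expR \o (fun t : R => - t^-1)).
      by apply/funext => t; rewrite exprfctE.
    apply: (is_derive_eq (is_deriveM hX hE)).
    rewrite /flat x0 /GRing.scale /= exprfctE; case: (k) => [|j].
      by rewrite oppr0 !mul0r !expr0 mulr0 addr0 add0r mul1r mulrC exprVn.
    rewrite /= -!exprVn !exprS; move: (expR (- x^-1)) (x^-1) (j.+1%:R : R) => e y c.
    by ring.

- have -> : - k%:R * flat k.+1 0 + flat k.+2 0 = 0.
    by rewrite /flat ltxx mulr0 addr0.
  suff h : h^-1 *: (flat k (h *: 1 + 0) - flat k 0) @[h --> 0^'] --> (0 : R).
    by apply: DeriveDef; [apply/cvg_ex; exists 0|exact/cvg_lim].
  apply/cvgrPdist_le => e e0.
  have F0 : 0 < (k.+2)`!%:R :> R by rewrite ltr0n fact_gt0.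
  near=> h; rewrite sub0r normrN addr0 {2}/flat ltxx subr0.
  have -> : h^-1 *: flat k (h *: 1) = flat k.+1 h.
    rewrite /GRing.scale /= mulr1 /flat; case: ifP => _; last by rewrite mulr0.
    by rewrite exprS mulrA.
  have [h0|h0] := leP 0 h; last by rewrite /flat ltNge (ltW h0)/= normr0 ltW.
  have /andP[f0 fle] := flat_le k.+1 h0.
  rewrite ger0_norm// (le_trans fle)// -ler_pdivlMl//.
  have : `|h| <= (k.+2)`!%:R^-1 * e.
    near: h; apply: dnbhs0_le; by rewrite mulr_gt0 ?invr_gt0.
  by rewrite ger0_norm.
Unshelve. all: by end_near. Qed.

Lemma ntimes_diff_flat n k : ntimes_diff n (flat k).
Proof.
elim: n k => [|n ih] k.
  move=> x; apply: differentiable_continuous; apply/derivable1_diffP.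
  by have [] := is_derive_flat k x.
exists ((cst (- k%:R) \* flat k.+1) \+ flat k.+2).
  by move=> x; exact: is_derive_flat.
apply: ntimes_diffD; last exact: ih.
by apply: ntimes_diffM; [exact: ntimes_diff_cst|exact: ih].
Qed.

Definition bump (a b x : R) : R := flat 0 (x - a) * flat 0 (b - x).

Lemma flat0_itv (t : R) : 0 <= flat 0 t < 1.
Proof.
rewrite /flat; case: ifPn => [t0|_]; last by rewrite lexx ltr01.
by rewrite expr0 mul1r expR_ge0 expR_lt1 oppr_lt0 invr_gt0.
Qed.

Lemma flat0_gt0 (t : R) : 0 < t -> 0 < flat 0 t.
Proof. by move=> t0; rewrite /flat t0 expr0 mul1r expR_gt0. Qed.

Lemma flat0_eq0 (t : R) : t <= 0 -> flat 0 t = 0.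
Proof. by rewrite leNgt /flat => /negbTE ->. Qed.

(** As [bump] takes values in [0, 1) and is positive on the interval only,
    these powers converge to the indicator of the interval as [j] grows. *)
Definition plateau (a b : R) (j : nat) (x : R) : R := 1 - (1 - bump a b x) ^+ j.

Lemma ntimes_diff_plateau n a b j : ntimes_diff n (plateau a b j).
Proof.
have hb : ntimes_diff n (bump a b).
  have -> : bump a b = (fun x => flat 0 (1 * x + - a)) \* (fun x => flat 0 (-1 * x + b)).
    by apply/funext => x; rewrite /bump /= mul1r mulN1r [b - x]addrC.
  by apply: ntimes_diffM; apply: ntimes_diff_affine; exact: ntimes_diff_flat.
have h1 : ntimes_diff n (cst 1 \+ (cst (-1) \* bump a b)).
  apply: ntimes_diffD; first exact: ntimes_diff_cst.
  by apply: ntimes_diffM => //; exact: ntimes_diff_cst.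
have -> : plateau a b j = cst 1 \+ (cst (-1) \*
    (fun x => (cst 1 \+ (cst (-1) \* bump a b)) x ^+ j)).
  by apply/funext => x; rewrite /plateau /= !mulN1r.
apply: ntimes_diffD; first exact: ntimes_diff_cst.
apply: ntimes_diffM; first exact: ntimes_diff_cst.
exact: ntimes_diffX.
Qed.

Lemma bump_itv a b x : 0 <= bump a b x < 1.
Proof.
have /andP[a0 a1] := flat0_itv (x - a); have /andP[b0 b1] := flat0_itv (b - x).
rewrite mulr_ge0//=; apply: le_lt_trans b1.
by rewrite ler_piMl// ltW.
Qed.

Lemma plateau_itv a b j x : 0 <= plateau a b j x <= 1.
Proof.
have /andP[b0 b1] := bump_itv a b x.
have b0' : 0 <= 1 - bump a b x by rewrite subr_ge0 ltW.
rewrite /plateau lerBlDr lerDl exprn_ge0// andbT subr_ge0 exprn_ile1//.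
by rewrite lerBlDr lerDl.
Qed.

Lemma plateau_out a b j x : ~ (a < x < b) -> plateau a b j x = 0.
Proof.
move=> xab; have b0 : bump a b x = 0.
  rewrite /bump; have [ax|xa] := ltP a x; last by rewrite flat0_eq0 ?mul0r// subr_le0.
  have [xb|bx] := ltP x b; first by exfalso; apply: xab; rewrite ax.
  by rewrite (@flat0_eq0 (b - x)) ?mulr0// subr_le0.
by rewrite /plateau b0 subr0 expr1n subrr.
Qed.

Lemma cvg_plateau a b x : plateau a b j x @[j --> \oo] --> (\1_(`]a, b[) x : R).
Proof.
rewrite indicE; have [|] := boolP (x \in _); rewrite ?(in_setE, notin_setE) /= in_itv/= => xab; last first.
  by under eq_fun do rewrite plateau_out//; exact: cvg_cst.
rewrite -[X in _ --> X]subr0; apply: cvgB; first exact: cvg_cst.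
have /andP[b0 b1] := bump_itv a b x; case/andP: xab => ax xb.
apply: cvg_expr; rewrite ger0_norm ?subr_ge0; last exact: ltW.
by rewrite ltrBlDr ltrDl /bump mulr_gt0// flat0_gt0// subr_gt0.
Qed.

End SmoothLine.

(** * Integrals over boxes determine a function *)

Section DynkinIntegral.
Context d d' (T : measurableType d) (S : measurableType d') (R : realType).
Variable mu : {measure set T -> \bar R}.

(** The sets [A] for which the integral over the preimage vanishes form a Dynkin
    system.  The map [p] and the set [D] allow treating the two coordinates of
    the plane one after the other. *)
Lemma integral0_generated (G : set (set S)) (p : T -> S) (D : set T) (f : T -> R) :
  @measurable _ S = <<s G >> -> setI_closed G -> G setT ->
  measurable_fun setT p -> measurable D -> mu.-integrable setT (EFin \o f) ->
  (forall A, G A -> (\int[mu]_(x in D `&` p @^-1` A) (f x)%:E = 0)%E) ->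
  forall A, measurable A -> (\int[mu]_(x in D `&` p @^-1` A) (f x)%:E = 0)%E.
Proof.
move=> mG GI GT mp mD fi fG A mA.
have mpI (B : set S) : measurable B -> measurable (D `&` p @^-1` B).
  by move=> mB; apply: measurableI => //; rewrite -[_ @^-1` _]setTI; exact: mp.
have [mf _] := integrableP _ _ _ fi.
apply: (@dynkin_induction _ _ G
  (fun B => (\int[mu]_(x in D `&` p @^-1` B) (f x)%:E = 0)%E) mG GI).
- exact: fG.
- exact: fG.
- move=> B mB B0; have := fG _ GT.
  rewrite preimage_setT setIT.
  have DE : D = (D `&` p @^-1` B) `|` (D `&` p @^-1` (~` B)).
    by rewrite -setIUr -preimage_setU setUv preimage_setT setIT.
  rewrite {1}DE integral_setU.
  + by rewrite B0 add0e.
  + exact: mpI.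
  + by apply: mpI; exact: measurableC.
  + exact: measurable_funS mf.
  + by apply/disj_setPS => x [[_ h] [_]].
- move=> F mF tF F0.
  rewrite preimage_bigcup setI_bigcupr integral_bigcup.
  + by apply: eseries0 => i _ _; exact: F0.
  + apply/trivIsetP => i j _ _ ij; move/trivIsetP: tF => /(_ i j I I ij) Fij.
    by rewrite setIACA setIid -preimage_setI Fij preimage_set0 setI0.
  + by move=> k; exact: mpI.
  + apply: integrableS fi => //.
    by apply: bigcupT_measurable => k; exact: mpI.
- by rewrite -mG.
Qed.

End DynkinIntegral.

Section Boxes.
Variable R : realType.
Local Notation mu2 := (@lebesgue_measure R \x @lebesgue_measure R)%E.
Local Notation plane := (measurableTypeR R * measurableTypeR R)%type.

#[global] Instance ae_plane_filter : Filter (almost_everywhere mu2) :=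
  ae_filter_ringOfSetsType _.

Definition obox (a b c d : R) : set (R * R) :=
  [set x | (a < x.1 < b) /\ (c < x.2 < d)].

Definition cbox (a b c d : R) : set (R * R) :=
  [set x | (a <= x.1 <= b) /\ (c <= x.2 <= d)].

Lemma oboxE a b c d : obox a b c d = `]a, b[%classic `*` `]c, d[%classic.
Proof. by apply/seteqP; split=> -[x y]; rewrite /obox /= !in_itv. Qed.

Lemma cboxE a b c d : cbox a b c d = `[a, b]%classic `*` `[c, d]%classic.
Proof. by apply/seteqP; split=> -[x y]; rewrite /cbox /= !in_itv. Qed.

Lemma obox_cbox a b c d : obox a b c d `<=` cbox a b c d.
Proof. by move=> x [/andP[? ?] /andP[? ?]]; split; rewrite !ltW. Qed.

Lemma measurable_obox a b c d : @measurable _ plane (obox a b c d).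
Proof. by rewrite oboxE; apply: measurableX. Qed.

Lemma measurable_cbox a b c d : @measurable _ plane (cbox a b c d).
Proof. by rewrite cboxE; apply: measurableX. Qed.

Lemma compact_cbox a b c d : compact (cbox a b c d).
Proof. by rewrite cboxE; apply: compact_setX; exact: segment_compact. Qed.

Definition ratbox (q : (rat * rat) * (rat * rat)) : set (R * R) :=
  obox (ratr q.1.1) (ratr q.1.2) (ratr q.2.1) (ratr q.2.2).

Lemma open_ratbox (U : set (R * R)) x : open U -> U x ->
  exists q : (rat * rat) * (rat * rat), ratbox q x /\
    cbox (ratr q.1.1) (ratr q.1.2) (ratr q.2.1) (ratr q.2.2) `<=` U.
Proof.
move=> oU Ux; have /nbhs_ballP[e /= e0 eU] := open_nbhs_nbhs (conj oU Ux).
have xl (y : R) : y - e < y by rewrite gtrBl.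
have xr (y : R) : y < y + e by rewrite ltrDl.
have [a] := rat_in_itvoo (xl x.1); rewrite in_itv /= => /andP[a1 a2].
have [b] := rat_in_itvoo (xr x.1); rewrite in_itv /= => /andP[b1 b2].
have [c] := rat_in_itvoo (xl x.2); rewrite in_itv /= => /andP[c1 c2].
have [d] := rat_in_itvoo (xr x.2); rewrite in_itv /= => /andP[d1 d2].
exists ((a, b), (c, d)); split; first by rewrite /ratbox /obox /= a2 b1 c2 d1.
move=> y [/= /andP[y1 y2] /andP[y3 y4]]; apply: eU; split; rewrite /ball /=;
  rewrite ltr_distlC; apply/andP; split.
- by apply: lt_le_trans y1.
- by apply: le_lt_trans b2.
- by apply: lt_le_trans y3.
- by apply: le_lt_trans d2.
Qed.

Lemma open_measurable2 (U : set (R * R)) : open U -> @measurable _ plane U.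
Proof.
move=> oU.
have -> : U = \bigcup_q (if pselect (ratbox q `<=` U) then ratbox q else set0).
  apply/seteqP; split => [x Ux|x [q _]]; last by case: pselect => // h /h.
  have [q [qx qU]] := open_ratbox oU Ux; exists q => //; case: pselect => //.
  by case; apply: subset_trans qU; exact: obox_cbox.
apply: countable_bigcupT_measurable => // q; case: (pselect _) => //= _.
exact: measurable_obox.
Qed.

(** An open set is a countable union of boxes with rational corners whose closures
    it contains. *)
Lemma ae_open (U : set (R * R)) (P : R * R -> Prop) : open U ->
  (forall a b c d, cbox a b c d `<=` U -> {ae mu2, forall x, obox a b c d x -> P x}) ->
  {ae mu2, forall x, U x -> P x}.
Proof.
move=> oU h.
pose Q n x := if unpickle n is Some q then
   cbox (ratr q.1.1) (ratr q.1.2) (ratr q.2.1) (ratr q.2.2) `<=` U ->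
   ratbox q x -> P x else True.
have hn n : {ae mu2, forall x, Q n x}.
  rewrite /Q; case: unpickle => [q|]; last by apply: aeW.
  have [qU|qU] := pselect (cbox (ratr q.1.1) (ratr q.1.2) (ratr q.2.1) (ratr q.2.2) `<=` U).
    by move: (h _ _ _ _ qU); apply: filterS => x hx _.
  by apply: aeW => x /qU.
have hQ : {ae mu2, forall x n, Q n x} by exact: ae_foralln.
apply: filterS hQ => x hx Ux; have [q [qx qU]] := open_ratbox oU Ux.
by have := hx (pickle q); rewrite /Q pickleK; exact.
Qed.

(** A generating family that is stable under intersection and whose products,
    once restricted to a box, are boxes again. *)
Definition rays : set (set R) := [set A | A = setT \/ exists x, A = `]x, +oo[%classic].

Lemma measurable_raysE : @measurable _ (measurableTypeR R) = <<s rays >>.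
Proof.
apply: (eq_trans (measurable_realfun.RGenOInfty.measurableE R)).
rewrite eqEsubset; split => A.
  apply: smallest_sub; first exact: smallest_sigma_algebra.
  by move=> B hB; apply: sub_sigma_algebra; right.
apply: smallest_sub; first exact: smallest_sigma_algebra.
move=> B [->|hB]; last exact: sub_sigma_algebra.
exact: (@measurableT _ (g_sigma_algebraType (@measurable_realfun.RGenOInfty.G R))).
Qed.

Lemma setI_rays : setI_closed rays.
Proof.
move=> A B [->|[x ->]] [->|[y ->]]; rewrite ?setTI ?setIT; [by left| | |];
  right; [by exists y|by exists x|].
exists (Num.max x y); apply/seteqP; split=> z /=; rewrite !in_itv/= !andbT gt_max.
  by case=> -> ->.
by move/andP.
Qed.

(** Rays generate the Borel sets of the line and rectangles those of the plane,
    so three applications of Dynkin's lemma (first coordinate, second coordinate,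
    rectangles) reduce all Borel sets to boxes. *)
Lemma ae0_boxes (f : R * R -> R) (a b c d : R) :
  mu2.-integrable (obox a b c d) (EFin \o f) ->
  (forall a' b' c' d', cbox a' b' c' d' `<=` cbox a b c d ->
     (\int[mu2]_(x in obox a' b' c' d') (f x)%:E = 0)%E) ->
  {ae mu2, forall x, obox a b c d x -> f x = 0}.
Proof.
move=> fi f0; set Q := obox a b c d; have mQ := measurable_obox a b c d.
pose g := f \_ Q.
have gi : mu2.-integrable setT (EFin \o g).
  by have /integrable_mkcond := fi; rewrite -restrict_EFin; exact.
have gE (A : set (R * R)) : (\int[mu2]_(x in A) (g x)%:E =
    \int[mu2]_(x in A `&` Q) (f x)%:E)%E.
  by rewrite integral_mkcondr; apply: eq_integral => x _; rewrite restrict_EFin.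
have h0 (X Y : set R) : rays X -> rays Y ->
    (\int[mu2]_(x in (snd @^-1` Y) `&` (fst @^-1` X)) (g x)%:E = 0)%E.
  move=> rX rY; rewrite gE.
  have [a' [aa' Xa']] : exists a', a <= a' /\ forall t, (X t /\ a < t) <-> a' < t.
    case: rX => [->|[x ->]]; first by exists a; split=> // t; split=> [[]|].
    exists (Num.max x a); split; first by rewrite le_max lexx orbT.
    move=> t /=; rewrite in_itv/= andbT gt_max; split=> [[-> ->]//|/andP//].
  have [c' [cc' Yc']] : exists c', c <= c' /\ forall t, (Y t /\ c < t) <-> c' < t.
    case: rY => [->|[x ->]]; first by exists c; split=> // t; split=> [[]|].
    exists (Num.max x c); split; first by rewrite le_max lexx orbT.
    move=> t /=; rewrite in_itv/= andbT gt_max; split=> [[-> ->]//|/andP//].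
  have -> : (snd @^-1` Y) `&` (fst @^-1` X) `&` Q = obox a' b c' d.
    apply/seteqP; split=> x.
      move=> [[/= Yx Xx] [/andP[ax xb] /andP[cx xd]]]; split; apply/andP; split=> //.
        exact/Xa'.
      exact/Yc'.
    move=> [/andP[ax xb] /andP[cx xd]].
    have [? ?] := (Xa' _).2 ax; have [? ?] := (Yc' _).2 cx.
    by split=> //; split; apply/andP.
  apply: f0 => x [/andP[ax xb] /andP[cx xd]].
  by split; apply/andP; split=> //; [exact: le_trans ax|exact: le_trans cx].
have mrays (X : set (measurableTypeR R)) : rays X -> measurable X.
  by move=> rX; rewrite measurable_raysE; exact: sub_sigma_algebra.
have mpre (p : plane -> measurableTypeR R) (X : set _) : measurable_fun setT p -> measurable X ->
    measurable (p @^-1` X).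
  by move=> mp mX; rewrite -[_ @^-1` _]setTI; exact: mp.
have h1 (X Y : set (measurableTypeR R)) : measurable X -> rays Y ->
    (\int[mu2]_(x in (snd @^-1` Y) `&` (fst @^-1` X)) (g x)%:E = 0)%E.
  move=> mX rY; apply: (integral0_generated measurable_raysE setI_rays) => //.
  - by left.
  - by apply: mpre => //; exact: mrays.
  - by move=> A rA; exact: h0.
have h2 (X Y : set (measurableTypeR R)) : measurable X -> measurable Y ->
    (\int[mu2]_(x in (fst @^-1` X) `&` (snd @^-1` Y)) (g x)%:E = 0)%E.
  move=> mX mY; apply: (integral0_generated measurable_raysE setI_rays) => //.
  - by left.
  - exact: mpre.
  - by move=> A rA; rewrite setIC; exact: h1.
have h3 (A : set plane) : measurable A -> (\int[mu2]_(x in A) (g x)%:E = 0)%E.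
  move=> mA; rewrite -[A]setTI -[A](preimage_id).
  apply: (integral0_generated (measurable_prod_measurableType (measurableTypeR R) (measurableTypeR R))) => //.
  - move=> _ _ [X mX [Y mY <-]] [X' mX' [Y' mY' <-]].
    by exists (X `&` X'); [exact: measurableI|
      exists (Y `&` Y'); [exact: measurableI|rewrite setXI]].
  - by exists setT => //; exists setT => //; rewrite setXTT.
  - move=> _ [X mX [Y mY <-]]; rewrite setTI preimage_id.
    have -> : X `*` Y = (fst @^-1` X) `&` (snd @^-1` Y) by [].
    exact: h2.
have : ae_eq mu2 setT (EFin \o g) (cst 0%E).
  apply: integral_ae_eq => // E _ mE; rewrite h3//.
  by rewrite integral0.
apply: filterS => x /(_ I) /= [gx] Qx; move: gx; rewrite /g patchE.
by rewrite mem_set.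
Qed.

End Boxes.

(** * Test functions and the fundamental lemma of the calculus of variations *)

Section TestFunctions.
Variable R : realType.
Local Notation mu2 := (@lebesgue_measure R \x @lebesgue_measure R)%E.
Local Notation plane := (measurableTypeR R * measurableTypeR R)%type.

(** The parametrisation of the line through [z] in direction [edir i] by its
    [i]-th coordinate; it turns partial derivatives into derivatives on [R]. *)
Definition coord_line (i : 'I_2) (z : R * R) (t : R) : R * R :=
  if i == ord0 then (t, z.2) else (z.1, t).

Definition coord (i : 'I_2) (z : R * R) : R := if i == ord0 then z.1 else z.2.

Lemma coord_lineE i (z : R * R) (h : R) :
  h *: edir R i + z = coord_line i z (h *: 1 + coord i z).
Proof.
case: z => x y; rewrite /edir /coord_line /coord.
by case: ifP => _; congr pair; rewrite /= /GRing.scale /= ?mulr0 ?mulr1 ?add0r.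
Qed.

Lemma coord_line_id i (z : R * R) : coord_line i z (coord i z) = z.
Proof. by case: z => x y; rewrite /coord_line /coord; case: (i == ord0). Qed.

Lemma is_derive_edir i (f : R * R -> R) (z : R * R) (l : R) :
  is_derive (coord i z) 1 (f \o coord_line i z) l <-> is_derive z (edir R i) f l.
Proof.
have E : (fun h : R => h^-1 *: (f (h *: edir R i + z) - f z)) =
    (fun h : R => h^-1 *: ((f \o coord_line i z) (h *: 1 + coord i z) -
                          (f \o coord_line i z) (coord i z))).
  by apply/funext => h; rewrite coord_lineE /= coord_line_id.
by split=> -[]; rewrite /derivable /derive => d1 d2; apply: DeriveDef;
  rewrite /derivable /derive; rewrite ?E // -?E.
Qed.

Definition tensor_fun (f g : R -> R) (x : R * R) : R := f x.1 * g x.2.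

Lemma is_derive_tensor i (f g df dg : R -> R) (z : R * R) :
  (forall x : R, is_derive x 1 f (df x)) -> (forall x : R, is_derive x 1 g (dg x)) ->
  is_derive z (edir R i) (tensor_fun f g)
    (if i == ord0 then tensor_fun df g z else tensor_fun f dg z).
Proof.
move=> fdf gdg; apply/is_derive_edir; rewrite /coord /coord_line /tensor_fun.
case: ifP => _.
  apply: (@is_derive_eq _ _ _ _ _ _ _ _ (is_deriveM (fdf z.1) (is_derive_cst (g z.2) _ _))).
  by rewrite scaler0 add0r /GRing.scale/= mulrC.
apply: (@is_derive_eq _ _ _ _ _ _ _ _ (is_deriveM (is_derive_cst (f z.1) _ _) (gdg z.2))).
by rewrite scaler0 addr0.
Qed.

Lemma continuous_tensor (f g : R -> R) :
  continuous f -> continuous g -> continuous (tensor_fun f g).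
Proof.
move=> cf cg z; apply: continuousM.
  by apply: continuous_comp; [exact: cvg_fst|exact: cf].
by apply: continuous_comp; [exact: cvg_snd|exact: cg].
Qed.

Lemma pderiv_tensor s n (f g : R -> R) :
  ntimes_diff (size s + n) f -> ntimes_diff (size s + n) g ->
  exists f' g', [/\ ntimes_diff n f', ntimes_diff n g' &
    pderiv s (tensor_fun f g) = tensor_fun f' g'].
Proof.
elim: s n => [|i s ih] n; first by exists f, g.
rewrite [size _]/= addSn -addnS => fn gn; have [f' [g' [fn' gn' E]]] := ih _ fn gn.
have [df fdf dfn] := fn'; have [dg gdg dgn] := gn'.
exists (if i == ord0 then df else f'), (if i == ord0 then g' else dg).
split; [by case: ifP => // _; exact: ntimes_diffW|
        by case: ifP => // _; exact: ntimes_diffW|].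
apply/funext => z; rewrite /= E; have [_ ->] := is_derive_tensor i z fdf gdg.
by case: ifP.
Qed.

Lemma smooth_tensor (f g : R -> R) : (forall n, ntimes_diff n f) ->
  (forall n, ntimes_diff n g) -> smooth (tensor_fun f g).
Proof.
move=> fn gn s.
have [f' [g' [fn' gn' ->]]] := pderiv_tensor (fn (size s + 1)%N) (gn (size s + 1)%N).
split.
  by apply: continuous_tensor; [exact: ntimes_diff_continuous fn'|exact: ntimes_diff_continuous gn'].
have [df fdf dfn] := fn'; have [dg gdg dgn] := gn'.
by move=> i x; have [] := is_derive_tensor i x fdf gdg.
Qed.

Definition box_plateau (a b c d : R) j : R * R -> R :=
  tensor_fun (plateau a b j) (plateau c d j).

Lemma test_box_plateau U a b c d j : cbox a b c d `<=` U ->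
  test_function U (box_plateau a b c d j).
Proof.
move=> QU; split.
  by apply: smooth_tensor => n; exact: ntimes_diff_plateau.
exists (cbox a b c d); split=> //; first exact: compact_cbox.
move=> x xQ; rewrite /box_plateau /tensor_fun.
have [h1|h1] := pselect (a < x.1 < b); last by rewrite plateau_out ?mul0r.
have [h2|h2] := pselect (c < x.2 < d); last by rewrite (plateau_out _ h2) mulr0.
by case: xQ; exact: obox_cbox.
Qed.

Lemma box_plateau_out a b c d j x : ~ obox a b c d x -> box_plateau a b c d j x = 0.
Proof.
move=> xQ; rewrite /box_plateau /tensor_fun.
have [h1|h1] := pselect (a < x.1 < b); last by rewrite plateau_out ?mul0r.
have [h2|h2] := pselect (c < x.2 < d); last by rewrite (plateau_out _ h2) mulr0.
by case: xQ.
Qed.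

Lemma box_plateau_itv a b c d j x : 0 <= box_plateau a b c d j x <= 1.
Proof.
have /andP[p0 p1] := plateau_itv a b j x.1; have /andP[q0 q1] := plateau_itv c d j x.2.
by rewrite /box_plateau /tensor_fun mulr_ge0//= mulr_ile1.
Qed.

Lemma cvg_box_plateau a b c d x : obox a b c d x ->
  box_plateau a b c d j x @[j --> \oo] --> (1 : R).
Proof.
move=> [xab xcd]; rewrite -[X in _ --> X]mulr1; apply: cvgM.
  have := @cvg_plateau R a b x.1; by rewrite indicE mem_set//= in_itv.
have := @cvg_plateau R c d x.2; by rewrite indicE mem_set//= in_itv.
Qed.

Lemma continuous_measurable2 (f : R * R -> R) :
  continuous f -> measurable_fun setT (f : plane -> R).
Proof.
move=> cf; apply: (measurability (@RGenOInfty.G R)).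
  exact: RGenOInfty.measurableE.
move=> _ [_ [a ->] <-]; rewrite setTI; apply: open_measurable2.
by apply: open_comp; [move=> x _; exact: cf|exact: interval_open].
Qed.

Lemma smooth_continuous (f : R * R -> R) : smooth f -> continuous f.
Proof. by move=> /(_ [::]) []. Qed.

(** The plateau functions of a box tend to 1 on it and are dominated by 1, so
    that the integral of [w] over every box inside [U] vanishes. *)
Lemma ae0_test_function (U : set (R * R)) (w : R * R -> R) : open U ->
  (forall a b c d, cbox a b c d `<=` U -> mu2.-integrable (obox a b c d) (EFin \o w)) ->
  (forall f, test_function U f -> int2 U (fun x => w x * f x) = 0) ->
  {ae mu2, forall x, U x -> w x = 0}.
Proof.
move=> oU wi w0; apply: ae_open => // a b c d QU.
apply: ae0_boxes; first exact: wi.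
move=> {}a' b' c' d' /subset_trans/(_ QU) {}QU.
have mQ := measurable_obox a' b' c' d'.
have QsU := subset_trans (@obox_cbox R a' b' c' d') QU.
have {}wi := wi _ _ _ _ QU; have [mw _] := integrableP _ _ _ wi.
pose f j (x : R * R) : R := w x * box_plateau a' b' c' d' j x.
have mf j : measurable_fun (obox a' b' c' d') (f j : plane -> R).
  apply: measurable_funM; first exact/measurable_EFinP.
  apply: measurable_funTS; apply: continuous_measurable2.
  by apply: smooth_continuous; have [] := test_box_plateau j QU.
have fle j x : `|f j x| <= `|w x|.
  have /andP[p0 p1] := box_plateau_itv a' b' c' d' j x.
  by rewrite normrM ler_piMr// ger0_norm.
have fi j : mu2.-integrable (obox a' b' c' d') (EFin \o f j).
  apply: le_integrable wi => //; first by apply/measurable_EFinP; exact: mf.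
  by move=> x _; rewrite lee_fin.
have f0 j : (\int[mu2]_(x in obox a' b' c' d') (f j x)%:E = 0)%E.
  have := w0 _ (test_box_plateau j QU).
  rewrite /int2 /Rintegral integral_mkcond.
  have -> : ((fun x => (w x * box_plateau a' b' c' d' j x)%:E) \_ U) =
            ((fun x => (f j x)%:E) \_ (obox a' b' c' d')).
    apply/funext => x; rewrite !patchE; case: ifPn => xU; case: ifPn => // xQ.
      by rewrite box_plateau_out ?mulr0//; move: xQ; rewrite notin_setE.
    by move: xU; rewrite notin_setE => -[]; apply: QsU; exact/set_mem.
  rewrite -integral_mkcond => h; rewrite -[LHS]fineK; first by rewrite h.
  have hh := integrable_fin_num mQ (fi j).
  exact: hh.
have [| | | | |_ _ h] := @dominated_convergence _ _ _ mu2 _ mQ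
   (fun j x => (f j x)%:E) (EFin \o w) (fun x => `|w x|%:E).
- by move=> j; apply/measurable_EFinP; exact: mf.
- exact: mw.
- apply: aeW => x Qx; apply: cvg_EFin; first by apply: nearW.
  rewrite -[X in _ --> X]mulr1; apply: cvgM; first exact: cvg_cst.
  exact: cvg_box_plateau.
- exact: integrable_abse wi.
- by apply: aeW => x j Qx; rewrite lee_fin.
have : (fun n => \int[mu2]_(x in obox a' b' c' d') (f n x)%:E)%E @ \oo --> (0%E : \bar R).
  by under eq_fun do rewrite f0; exact: cvg_cst.
by move=> h0; exact: (cvg_unique _ h h0).
Qed.

End TestFunctions.

(** * Square integrable functions *)

Section L2.
Variable R : realType.
Local Notation mu2 := (@lebesgue_measure R \x @lebesgue_measure R)%E.
Local Notation plane := (measurableTypeR R * measurableTypeR R)%type.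
Implicit Types (U : set (R * R)) (f g : R * R -> R).

Lemma inL2P U f : @measurable _ plane U -> inL2 U f <->
  measurable_fun (U : set plane) (f : plane -> R) /\
  mu2.-integrable U (fun x => (f x ^+ 2)%:E).
Proof.
move=> mU; have rE : (fun x : plane => (f x ^+ 2)%:E) \_ U =
    (fun x => ((f \_ U) x ^+ 2)%:E).
  apply/funext => x; rewrite !patchE; case: ifP => // _.
  by rewrite expr0n.
split.
  move=> Lf; split.
    apply/(measurable_restrictT _ mU); move: Lf; rewrite /inL2 inE => /andP[].
    by rewrite inE.
  by apply/(integrable_mkcond _ mU); rewrite rE; exact: Lfun2_integrable_sqr.
move=> [mf /(integrable_mkcond _ mU)]; rewrite rE => /integrableP[_ fi].
rewrite /inL2 inE; apply/andP; split; rewrite inE /=.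
  exact/(measurable_restrictT _ mU).
rewrite /finite_norm unlock /Lnorm.
rewrite poweR_lty//; apply: le_lt_trans fi.
rewrite le_eqVlt; apply/orP; left; apply/eqP; apply: eq_integral => x _.
transitivity ((`|(f \_ U) x|%:E `^ 2)%E); first by [].
by rewrite poweR_EFin /= powR_mulrn// real_normK ?num_real// ger0_norm ?sqr_ge0.
Qed.

Lemma inL2_measurable U f : @measurable _ plane U -> inL2 U f ->
  measurable_fun (U : set plane) (f : plane -> R).
Proof. by move=> mU /(inL2P _ mU)[]. Qed.

Lemma inL2_lincomb U a f g : inL2 U f -> inL2 U g -> inL2 U (lincomb a f g).
Proof.
move=> Lf Lg; rewrite /inL2.
have -> : lincomb a f g \_ U = a *: (f \_ U) + g \_ U.
  apply/funext => x; rewrite /lincomb !fctE !patchE /=.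
  by case: ifP => // _; rewrite /GRing.scale /= mulr0 addr0.
have := @Lfun_submod_closed _ plane R mu2 2%:E.
by rewrite lee1n => /(_ isT) [_ h]; exact: h.
Qed.

Lemma inL2_le U f g : @measurable _ plane U ->
  measurable_fun (U : set plane) (f : plane -> R) ->
  (forall x, U x -> `|f x| <= `|g x|) -> inL2 U g -> inL2 U f.
Proof.
move=> mU mf fg /(inL2P _ mU)[mg gi]; apply/(inL2P _ mU); split => //.
apply: (le_integrable mU _ _ gi); first by apply/measurable_EFinP; exact: measurable_funX.
by move=> x Ux /=; rewrite lee_fin !normrX lerXn2r ?nnegrE ?fg.
Qed.

Lemma inL2_mul U f g : @measurable _ plane U -> inL2 U f -> inL2 U g ->
  mu2.-integrable U (fun x => (f x * g x)%:E).
Proof.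
move=> mU Lf Lg; apply/(integrable_mkcond _ mU).
have /Lfun1_integrable := Lfun2_mul_Lfun1 Lf Lg.
congr (integrable _ _ _); apply/funext => x; rewrite /= !patchE.
by case: ifP => // _; rewrite mulr0.
Qed.

Lemma inL2_sub U' U f : @measurable _ plane U -> @measurable _ plane U' ->
  U' `<=` U -> inL2 U f -> inL2 U' f.
Proof.
move=> mU mU' sU /(inL2P _ mU)[mf fi]; apply/(inL2P _ mU'); split.
  exact: measurable_funS mf.
exact: integrableS fi.
Qed.

Lemma inL2_bounded U f (M : R) : @measurable _ plane U -> (mu2 U < +oo)%E ->
  measurable_fun (U : set plane) (f : plane -> R) ->
  (forall x, U x -> `|f x| <= M) -> inL2 U f.
Proof.
move=> mU Uoo mf fM.
apply: (@inL2_le _ _ (cst M)) => //.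
  by move=> x Ux; rewrite (le_trans (fM _ Ux))// ler_norm.
apply/(inL2P _ mU); split; first exact: measurable_cst.
apply/integrableP; split.
  by apply/measurable_EFinP; apply: measurable_funX; exact: measurable_cst.
rewrite [X in (X < _)%E](_ : _ = \int[mu2]_(x in U) cst (`|M ^+ 2|%:E) x)%E//.
by rewrite integral_cst// lte_mul_pinfty.
Qed.

Lemma int2_lincomb U a f g : @measurable _ plane U ->
  mu2.-integrable U (EFin \o f) -> mu2.-integrable U (EFin \o g) ->
  int2 U (lincomb a f g) = a * int2 U f + int2 U g.
Proof.
move=> mU fi gi; rewrite /int2 -RintegralZl// -RintegralD//.
by have := integrableZl mU a fi; apply: eq_integrable => // x _.
Qed.

Lemma int2_ae U f g : @measurable _ plane U ->
  measurable_fun (U : set plane) (f : plane -> R) ->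
  measurable_fun (U : set plane) (g : plane -> R) ->
  ae_eq_on U f g -> int2 U f = int2 U g.
Proof.
move=> mU mf mg fg; rewrite /int2 /Rintegral; congr fine.
apply: ae_eq_integral => //; try exact/measurable_EFinP.
by apply: filterS fg => x h Ux; rewrite h.
Qed.

Lemma eq_int2 U f g : (forall x, U x -> f x = g x) -> int2 U f = int2 U g.
Proof. by move=> fg; apply: eq_Rintegral => x; rewrite inE => /fg. Qed.

Lemma int2_sub U' U f : U' `<=` U -> (forall x, ~ U' x -> f x = 0) ->
  int2 U f = int2 U' f.
Proof.
move=> UU f0; rewrite /int2 Rintegral_mkcond [RHS]Rintegral_mkcond.
apply: eq_Rintegral => x _; rewrite !patchE; case: ifPn; case: ifPn => //.
  by rewrite notin_setE => /f0.
by rewrite inE notin_setE => /UU.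
Qed.

Lemma int2_ge0 U f : (forall x, U x -> 0 <= f x) -> 0 <= int2 U f.
Proof. by move=> f0; apply/fine_ge0/integral_ge0 => x Ux; rewrite lee_fin f0. Qed.

Lemma ae_eq_on_refl U f : ae_eq_on U f f.
Proof. by apply: aeW. Qed.

Lemma ae_eq_on_sym U f g : ae_eq_on U f g -> ae_eq_on U g f.
Proof. by apply: filterS => x h /h ->. Qed.

Lemma inL2_ae U f g : @measurable _ plane U ->
  measurable_fun (U : set plane) (g : plane -> R) ->
  ae_eq_on U f g -> inL2 U f -> inL2 U g.
Proof.
move=> mU mg fg /(inL2P _ mU)[mf fi]; apply/(inL2P _ mU); split => //.
apply/integrableP; split; first by apply/measurable_EFinP; exact: measurable_funX.
have [_] := integrableP _ _ _ fi; congr (_ < _)%E.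
apply: ae_eq_integral => //.
- by apply: measurableT_comp => //; apply/measurable_EFinP; exact: measurable_funX.
- by apply: measurableT_comp => //; apply/measurable_EFinP; exact: measurable_funX.
- by apply: filterS fg => x h Ux; rewrite h.
Qed.

(** The common source of the Cauchy-Schwarz inequalities below.  For [0 < C] the
    hypothesis is used at the vertex [- B / C]; for [C <= 0] and [0 < B] it fails
    at [- (A + 1) / B]. *)
Lemma discriminant_le (A B C : R) : (forall t, 0 <= A + 2 * t * B + t ^+ 2 * C) ->
  B <= Num.sqrt A * Num.sqrt C.
Proof.
move=> h; have A0 : 0 <= A by have := h 0; rewrite mulr0 mul0r expr0n /= mul0r !addr0.
have [B0|B0] := leP B 0; first by rewrite (le_trans B0)// mulr_ge0 ?sqrtr_ge0.
rewrite -sqrtrM// -(ger0_norm (ltW B0)) -sqrtr_sqr; apply: ler_wsqrtr.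
have [C0|C0] := leP C 0.
  exfalso; have := h (- (A + 1) / B); have Bn : B != 0 by rewrite gt_eqF.
  have -> : 2 * (- (A + 1) / B) * B = - 2 * (A + 1) by field.
  have := sqr_ge0 (- (A + 1) / B); move: (_ ^+ 2) => q q0.
  have : q * C <= 0 by rewrite mulr_ge0_le0.
  by lra.
have Cn : C != 0 by rewrite gt_eqF.
have := h (- B / C).
have -> : A + 2 * (- B / C) * B + (- B / C) ^+ 2 * C = (A * C - B ^+ 2) / C by field.
by rewrite pmulr_lge0 ?invr_gt0// subr_ge0.
Qed.

Lemma discriminant (A B C : R) : (forall t, 0 <= A + 2 * t * B + t ^+ 2 * C) ->
  `|B| <= Num.sqrt A * Num.sqrt C.
Proof.
move=> h; rewrite ler_norml -lerN2 opprK; apply/andP; split.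
  by apply: discriminant_le => t; have := h (- t); rewrite sqrrN !mulrN mulNr.
exact: discriminant_le.
Qed.

Lemma int2_cauchy_schwarz U f g : @measurable _ plane U ->
  inL2 U f -> inL2 U g -> `|int2 U (fun x => f x * g x)| <= l2norm U f * l2norm U g.
Proof.
move=> mU Lf Lg; apply: discriminant => t.
have [_ fi] := (inL2P f mU).1 Lf; have [_ gi] := (inL2P g mU).1 Lg.
have fgi := inL2_mul mU Lf Lg.
have i1 : mu2.-integrable U (EFin \o lincomb (2 * t) (fun x => f x * g x) (fun x => f x ^+ 2)).
  have := integrableD mU (integrableZl mU (2 * t) fgi) fi.
  by apply: eq_integrable.
rewrite [_ + 2 * t * _]addrC -int2_lincomb// [_ + _ * _]addrC -int2_lincomb//.
apply: int2_ge0 => x _; rewrite /lincomb.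
rewrite (_ : _ + _ = (f x + t * g x) ^+ 2) ?sqr_ge0//; ring.
Qed.

End L2.

(** * Weak derivatives *)

Section WeakDerivatives.
Variable R : realType.
Local Notation mu2 := (@lebesgue_measure R \x @lebesgue_measure R)%E.
Local Notation plane := (measurableTypeR R * measurableTypeR R)%type.
Implicit Types (U K : set (R * R)) (f g v w : R * R -> R) (s : seq 'I_2).

(** Near a point outside the closed set [K], [f] coincides with the zero
    function. *)
Lemma pderiv_support K f s : closed K -> (forall x, ~ K x -> f x = 0) ->
  forall x, ~ K x -> pderiv s f x = 0.
Proof.
move=> cK f0; elim: s => [//|i s ih] x Kx /=.
rewrite (@near_eq_derive _ _ _ (pderiv s f) (cst 0)) ?derive_cst//.
have oK : open_nbhs x (~` K) by split=> //; exact: closed_openC.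
by apply: filterS (open_nbhs_nbhs oK) => y /ih.
Qed.

Lemma bounded_set_cbox K : bounded_set K -> exists M : R, K `<=` cbox (- M) M (- M) M.
Proof.
move=> [M [_ hM]]; exists (M + 1) => x /hM h.
have {}h : `|x| <= M + 1 by apply: h; rewrite ltrDl.
have h1 : `|x.1| <= M + 1 by apply: le_trans h; rewrite /Num.norm /= le_max lexx.
have h2 : `|x.2| <= M + 1 by apply: le_trans h; rewrite /Num.norm /= le_max lexx orbT.
by rewrite /cbox /= -!ler_norml.
Qed.

Lemma mu_cbox_lty (a b c d : R) : (mu2 (cbox a b c d) < +oo)%E.
Proof.
rewrite cboxE product_measure1E; [|exact: measurable_itv|exact: measurable_itv].
have oo (x y : R) : (@lebesgue_measure R `[x, y]%classic < +oo)%E.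
  by rewrite lebesgue_measure_itv /=; case: ifP => _; rewrite ?ltry// -EFinB ltry.
by apply: lte_mul_pinfty; [exact: measure_ge0|rewrite ge0_fin_numE//; exact: oo|exact: oo].
Qed.

Lemma mu_bounded_lty U : @measurable _ plane U -> bounded_set U -> (mu2 U < +oo)%E.
Proof.
move=> mU /bounded_set_cbox[M UM]; apply: le_lt_trans (mu_cbox_lty (-M) M (-M) M).
by apply: le_measure; rewrite ?inE//; exact: measurable_cbox.
Qed.

Lemma inL2_compact_support K f U : @measurable _ plane U -> compact K ->
  continuous f -> (forall x, ~ K x -> f x = 0) -> inL2 U f.
Proof.
move=> mU cK cf f0.
have [M KM] := bounded_set_cbox (compact_bounded cK).
have [B [_ hB]] : bounded_set (f @` cbox (- M) M (- M) M).
  apply: compact_bounded; apply: continuous_compact; last exact: compact_cbox.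
  exact: continuous_subspaceT.
have mf : measurable_fun setT (f : plane -> R) by exact: continuous_measurable2.
apply: (@inL2_sub _ U setT) => //.
have mQ := @measurable_cbox R (- M) M (- M) M.
have /(inL2P _ mQ)[_ fi] : inL2 (cbox (- M) M (- M) M) f.
  apply: (@inL2_bounded _ _ _ (B + 1)) => //.
  - exact: mu_cbox_lty.
  - exact: measurable_funS mf.
  - by move=> x Qx; apply: hB; rewrite ?ltrDl//; exists x.
apply/(inL2P _ measurableT); split => //.
move/(integrable_mkcond _ mQ) : fi; congr (integrable _ _ _).
apply/funext => x; rewrite patchE; case: ifPn => //; rewrite notin_setE => xQ.
by rewrite f0 ?expr0n//= => /KM.
Qed.

Lemma test_pderiv U f s : test_function U f -> continuous (pderiv s f) /\
  exists K, [/\ compact K, K `<=` U & forall x, ~ K x -> pderiv s f x = 0].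
Proof.
move=> [sf [K [cK KU f0]]]; split; first by have [] := sf s.
exists K; split => //; apply: pderiv_support => //.
by apply: compact_closed => //; exact: norm_hausdorff.
Qed.

Lemma test_inL2 U U' f s : @measurable _ plane U' -> test_function U f ->
  inL2 U' (pderiv s f).
Proof.
move=> mU /(test_pderiv s)[cf [K [cK _ f0]]].
exact: inL2_compact_support f0.
Qed.

Lemma test_functionS U U' f : U' `<=` U -> test_function U' f -> test_function U f.
Proof.
by move=> UU [sf [K [cK KU f0]]]; split=> //; exists K; split=> //; exact: subset_trans UU.
Qed.

Lemma weak_lincomb U s a v1 v2 w1 w2 : @measurable _ plane U ->
  inL2 U v1 -> inL2 U v2 -> inL2 U w1 -> inL2 U w2 ->
  is_weak_derivative U s v1 w1 -> is_weak_derivative U s v2 w2 ->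
  is_weak_derivative U s (lincomb a v1 v2) (lincomb a w1 w2).
Proof.
move=> mU Lv1 Lv2 Lw1 Lw2 h1 h2 f tf.
have Lf := test_inL2 [::] mU tf; have Ldf := test_inL2 s mU tf.
have E (x1 x2 y : R * R -> R) : inL2 U x1 -> inL2 U x2 -> inL2 U y ->
    int2 U (fun x => lincomb a x1 x2 x * y x) =
    a * int2 U (fun x => x1 x * y x) + int2 U (fun x => x2 x * y x).
  move=> L1 L2 Ly; rewrite -int2_lincomb//; try exact: inL2_mul.
  by apply: eq_int2 => x _; rewrite /lincomb mulrDl mulrA.
by rewrite !E// h1// h2//; ring.
Qed.

Lemma inL2_integrable U f : @measurable _ plane U -> (mu2 U < +oo)%E ->
  inL2 U f -> mu2.-integrable U (EFin \o f).
Proof.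
move=> mU Uoo Lf; have L1 : inL2 U (cst 1).
  apply: (@inL2_bounded _ _ _ 1) => //.
  by move=> x _; rewrite normr1.
have := inL2_mul mU Lf L1; apply: eq_integrable => // x _ /=.
by rewrite mulr1.
Qed.

(** The difference of two weak derivatives is square integrable and orthogonal to
    all test functions. *)
Lemma weak_unique U s v w1 w2 : open U -> inL2 U w1 -> inL2 U w2 ->
  is_weak_derivative U s v w1 -> is_weak_derivative U s v w2 -> ae_eq_on U w1 w2.
Proof.
move=> oU L1 L2 h1 h2; have mU := open_measurable2 oU.
have Lw : inL2 U (lincomb (-1) w2 w1) by exact: inL2_lincomb.
have : {ae mu2, forall x, U x -> lincomb (-1) w2 w1 x = 0}.
  apply: ae0_test_function => //.
    move=> a b c d QU; have mQ := measurable_obox a b c d.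
    apply: inL2_integrable => //.
      apply: le_lt_trans (mu_cbox_lty a b c d); apply: le_measure; rewrite ?inE//.
        exact: measurable_cbox.
      exact: obox_cbox.
    by apply: (inL2_sub mU mQ) => //; apply: subset_trans QU; exact: obox_cbox.
  move=> f tf; have Lf := test_inL2 [::] mU tf.
  have := h1 f tf; rewrite h2// => /(can_inj (signrMK _)) E.
  transitivity (- 1 * int2 U (fun x => w2 x * f x) + int2 U (fun x => w1 x * f x)).
    rewrite -int2_lincomb//; try exact: inL2_mul.
    by apply: eq_int2 => x _; rewrite /lincomb mulrDl mulrA.
  by rewrite E mulN1r addNr.
apply: filterS => x h Ux; have := h Ux; rewrite /lincomb mulN1r addrC => /eqP.
by rewrite subr_eq0 => /eqP.
Qed.

Definition has_wderiv U s v : Prop := exists w, inL2 U w /\ is_weak_derivative U s v w.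

Lemma wderivP U s v : has_wderiv U s v ->
  inL2 U (wderiv U s v) /\ is_weak_derivative U s v (wderiv U s v).
Proof.
by move=> [w hw]; have := @xgetPex _ (fun=> 0)
  [set w | inL2 U w /\ is_weak_derivative U s v w] (ex_intro _ w hw).
Qed.

Lemma wderiv_eq U s v w : open U -> inL2 U w -> is_weak_derivative U s v w ->
  ae_eq_on U (wderiv U s v) w.
Proof.
move=> oU Lw hw; have [Ld hd] := wderivP (ex_intro _ w (conj Lw hw)).
exact: weak_unique hd hw.
Qed.

Lemma has_wderiv_lincomb U s a v1 v2 : @measurable _ plane U -> inL2 U v1 -> inL2 U v2 ->
  has_wderiv U s v1 -> has_wderiv U s v2 -> has_wderiv U s (lincomb a v1 v2).
Proof.
move=> mU L1 L2 [w1 [Lw1 h1]] [w2 [Lw2 h2]]; exists (lincomb a w1 w2).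
by split; [exact: inL2_lincomb|exact: weak_lincomb].
Qed.

Lemma wderiv_lincomb U s a v1 v2 : open U -> inL2 U v1 -> inL2 U v2 ->
  has_wderiv U s v1 -> has_wderiv U s v2 ->
  ae_eq_on U (wderiv U s (lincomb a v1 v2))
             (lincomb a (wderiv U s v1) (wderiv U s v2)).
Proof.
move=> oU L1 L2 /wderivP[Lw1 h1] /wderivP[Lw2 h2].
apply: wderiv_eq => //; first exact: inL2_lincomb.
by apply: weak_lincomb => //; exact: open_measurable2.
Qed.

Lemma weak_sub U U' s v w : U' `<=` U ->
  is_weak_derivative U s v w -> is_weak_derivative U' s v w.
Proof.
move=> UU h f tf; have := h f (test_functionS UU tf).
have E (y : R * R -> R) t :
    int2 U (fun x => y x * pderiv t f x) = int2 U' (fun x => y x * pderiv t f x).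
  have [_ [K [_ KU f0]]] := test_pderiv t tf.
  by apply: int2_sub => // x Ux; rewrite f0 ?mulr0// => /KU.
by rewrite (E v s) (E w [::]).
Qed.

(** Test functions of the smaller set are test functions of the larger one, hence
    restrictions of weak derivatives are weak derivatives; uniqueness then
    compares the two selected representatives. *)
Lemma wderiv_sub U U' s v : open U -> open U' -> U' `<=` U -> has_wderiv U s v ->
  has_wderiv U' s v /\ ae_eq_on U' (wderiv U' s v) (wderiv U s v).
Proof.
move=> oU oU' UU /wderivP[Lw hw].
have Lw' : inL2 U' (wderiv U s v).
  by apply: inL2_sub Lw => //; exact: open_measurable2.
have hw' := weak_sub UU hw.
by split; [exists (wderiv U s v)|exact: wderiv_eq].
Qed.

Lemma weak_ae U s v v' w : @measurable _ plane U -> inL2 U v -> inL2 U v' ->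
  ae_eq_on U v v' -> is_weak_derivative U s v w -> is_weak_derivative U s v' w.
Proof.
move=> mU Lv Lv' vv h f tf; rewrite -h//; have Lf := test_inL2 s mU tf.
apply: int2_ae => //.
- by apply: measurable_funM; [exact: inL2_measurable Lv'|exact: inL2_measurable Lf].
- by apply: measurable_funM; [exact: inL2_measurable Lv|exact: inL2_measurable Lf].
- by apply: filterS vv => x h' Ux; rewrite h'.
Qed.

(** The equality is not merely almost everywhere: the two functions have the same
    weak derivatives, so the same representative is selected. *)
Lemma wderiv_ae U s v v' : @measurable _ plane U -> inL2 U v -> inL2 U v' ->
  ae_eq_on U v v' -> wderiv U s v = wderiv U s v'.
Proof.
move=> mU Lv Lv' vv; rewrite /wderiv; congr (xget _ _).
apply/seteqP; split=> w /= [Lw hw]; split=> //; first exact: weak_ae vv hw.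
by apply: weak_ae hw => //; exact: ae_eq_on_sym.
Qed.

End WeakDerivatives.

(** * Triangles and triangulations *)

Section Triangles.
Variable R : realType.
Local Notation mu2 := (@lebesgue_measure R \x @lebesgue_measure R)%E.
Local Notation plane := (measurableTypeR R * measurableTypeR R)%type.
Implicit Types (p : 'I_3 -> R * R) (x : R * R).

Lemma sum3 (V : zmodType) (F : 'I_3 -> V) :
  \sum_k F k = F (inord 0) + F (inord 1) + F (inord 2).
Proof.
rewrite !big_ord_recl big_ord0 addr0 addrA.
by congr (F _ + F _ + F _); apply/val_inj; rewrite /= inordK.
Qed.

Lemma ord3P (k : 'I_3) : [\/ k = inord 0, k = inord 1 | k = inord 2].
Proof.
by case: k => [[|[|[|//]]] hk]; [constructor 1|constructor 2|constructor 3];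
  apply/val_inj; rewrite /= inordK.
Qed.

Definition area2 p : R :=
  (p (inord 1) - p (inord 0)).1 * (p (inord 2) - p (inord 0)).2 -
  (p (inord 1) - p (inord 0)).2 * (p (inord 2) - p (inord 0)).1.

(** The barycentric coordinates solve a linear system with determinant [area2 p]
    (Cramer's rule); they are kept in the form [c.1.1 * x.1 + c.1.2 * x.2 + c.2]
    so that their zero sets are visibly lines. *)
Definition bary_coef p (k : 'I_3) : R * R * R :=
  let p0 := p (inord 0) in
  let d := p (inord 1) - p (inord 0) in let e := p (inord 2) - p (inord 0) in
  let D := area2 p in
  if k == inord 1 then (e.2 / D, - e.1 / D, (p0.2 * e.1 - p0.1 * e.2) / D)
  else if k == inord 2 then (- d.2 / D, d.1 / D, (p0.1 * d.2 - p0.2 * d.1) / D)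
  else ((d.2 - e.2) / D, (e.1 - d.1) / D,
        1 - (p0.2 * e.1 - p0.1 * e.2) / D - (p0.1 * d.2 - p0.2 * d.1) / D).

Definition affine_form (c : R * R * R) x : R := c.1.1 * x.1 + c.1.2 * x.2 + c.2.

Definition bary p k x : R := affine_form (bary_coef p k) x.

Lemma inord_eqF : ((inord 1 == inord 2 :> 'I_3) = false) * ((inord 2 == inord 1 :> 'I_3) = false)
 * ((inord 0 == inord 1 :> 'I_3) = false) * ((inord 0 == inord 2 :> 'I_3) = false).
Proof. by do !split; apply/eqP => /(congr1 val); rewrite /= !inordK. Qed.

Lemma bary_comb p (l : 'I_3 -> R) k : Defs.nondegenerate p -> \sum_j l j = 1 ->
  bary p k (\sum_j l j *: p j) = l k.
Proof.
move=> nd; have D0 : area2 p != 0 by [].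
rewrite !sum3 => l1; have {}l1 : l (inord 0) = 1 - l (inord 1) - l (inord 2).
  by rewrite -l1; ring.
case: (ord3P k) => ->; rewrite /bary /bary_coef !inord_eqF ?eqxx /affine_form;
  move: D0; rewrite /area2; rewrite /= l1 /GRing.scale /=;
  move: (p _) (p _) (p _) (l _) (l _) => [x2 y2] [x1 y1] [x0 y0] a b /= D0; field => //.
Qed.

Lemma bary_sum p x : Defs.nondegenerate p ->
  \sum_k bary p k x = 1 /\ \sum_k bary p k x *: p k = x.
Proof.
move=> nd; have D0 : area2 p != 0 by [].
rewrite !sum3 /bary /bary_coef !inord_eqF ?eqxx /affine_form.
split.
  by rewrite /=; ring.
move: D0; rewrite /area2.
move: (p _) (p _) (p _) x => [x2 y2] [x1 y1] [x0 y0] [x y] /= D0.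
congr pair; rewrite /= /GRing.scale /=; field => //.
Qed.

Lemma triP p x : Defs.nondegenerate p -> tri p x <-> forall k, 0 <= bary p k x.
Proof.
move=> nd; split=> [[l [l0 _ l1 ->]] k|b0]; first by rewrite bary_comb.
have [b1 bx] := bary_sum x nd; exists (bary p ^~ x); split => //.
by move=> k; rewrite inE.
Qed.

Lemma continuous_affine_form c : continuous (affine_form c).
Proof.
move=> x.
apply: (@continuousD _ _ _ (fun x => c.1.1 * x.1 + c.1.2 * x.2) (cst c.2));
  last exact: cst_continuous.
apply: (@continuousD _ _ _ (fun x => c.1.1 * x.1) (fun x => c.1.2 * x.2)).
  by apply: (@continuousM _ _ (cst c.1.1) fst); [exact: cst_continuous|exact: cvg_fst].
by apply: (@continuousM _ _ (cst c.1.2) snd); [exact: cst_continuous|exact: cvg_snd].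
Qed.

Lemma tri_interior p x : Defs.nondegenerate p -> (forall k, 0 < bary p k x) -> (tri p)° x.
Proof.
move=> nd b0; have h : \forall y \near x, forall k, 0 < bary p k y.
  apply: (@filter_forall _ _ (fun k y => 0 < bary p k y) (nbhs x)) => k.
  by have := @continuous_affine_form (bary_coef p k) x; move/cvgr_gt; apply; exact: b0.
by apply: filterS h => y hy; apply/triP => // k; exact: ltW.
Qed.

(** By Fubini's theorem: a line that is not vertical meets each vertical line in
    one point, and a vertical line is the product of a point and the real line. *)
Lemma ae_affine_form c : c.1 != 0 -> {ae mu2, forall x, affine_form c x != 0}.
Proof.
move=> c0.
have oN : open (~` [set x | affine_form c x = 0]).
  have -> : ~` [set x | affine_form c x = 0] = affine_form c @^-1` [set t | t != 0].
    by apply/seteqP; split=> x /= /eqP.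
  by apply: open_comp; [move=> x _; exact: continuous_affine_form|exact: open_neq].
have mN : @measurable _ plane [set x | affine_form c x = 0].
  by rewrite -[X in measurable X]setCK; apply: measurableC; exact: open_measurable2.
exists [set x | affine_form c x = 0]; split => //; last by move=> x /= /negP/negPn/eqP.
have [b0|b0] := eqVneq c.1.2 0.
  have a0 : c.1.1 != 0.
    apply: contra c0 => /eqP a0; apply/eqP; rewrite [c.1]surjective_pairing a0 b0.
    by [].
  have -> : [set x | affine_form c x = 0] = [set - c.2 / c.1.1] `*` setT.
    apply/seteqP; split=> x /=; rewrite /affine_form b0 mul0r addr0.
      move=> /eqP; rewrite addr_eq0 => /eqP h; split=> //.
      by rewrite -h mulrC mulKf.
    by move=> [-> _]; field.
  rewrite product_measure1E//.
  transitivity (0 * @lebesgue_measure R setT)%E; last exact: mul0e.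
  by congr (_ * _)%E; exact: lebesgue_measure_set1.
rewrite /product_measure1 /=; apply: integral0_eq => t _ /=.
have -> : xsection [set x | affine_form c x = 0] t = [set (- c.2 - c.1.1 * t) / c.1.2].
  apply/seteqP; split=> y; rewrite /xsection /affine_form /= inE /=.
    by move=> h; apply: (canRL (mulfK b0)); rewrite -[RHS]addr0 -h; ring.
  by move=> ->; field.
exact: lebesgue_measure_set1.
Qed.

(** Otherwise the coordinate would be constant, but it takes the values 0 and 1 at
    the vertices. *)
Lemma bary_coef_neq0 p k : Defs.nondegenerate p -> (bary_coef p k).1 != 0.
Proof.
move=> nd; have D0 : area2 p != 0 by [].
apply/eqP => h.
have bE x : bary p k x = (bary_coef p k).2 by rewrite /bary /affine_form h /= !mul0r !add0r.
have e0 (j : 'I_3) : \sum_i (i == j)%:R = 1 :> R.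
  by rewrite (bigD1 j)//= eqxx big1 ?addr0// => i /negbTE ->.
have pE j : \sum_i (i == j)%:R *: p i = p j.
  by rewrite (bigD1 j)//= eqxx scale1r big1 ?addr0// => i /negbTE ->; rewrite scale0r.
have [j kj] : exists j : 'I_3, k != j.
  case: (ord3P k) => ->; [exists (inord 1)|exists (inord 2)|exists (inord 1)];
  by rewrite inord_eqF.
have := bary_comb k nd (e0 k); rewrite bE eqxx.
have := bary_comb k nd (e0 j); rewrite bE (negbTE kj) => -> /eqP.
by rewrite eq_sym oner_eq0.
Qed.

Lemma ae_bary p : Defs.nondegenerate p -> {ae mu2, forall x, forall k, bary p k x != 0}.
Proof.
by move=> nd; apply: filter_forall => k; apply: ae_affine_form; exact: bary_coef_neq0.
Qed.

Lemma ae_tri_interior p : Defs.nondegenerate p -> {ae mu2, forall x, tri p x -> (tri p)° x}.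
Proof.
move=> nd; apply: filterS (ae_bary nd) => x h /(triP _ nd) b0.
by apply: tri_interior => // k; rewrite lt0r h b0.
Qed.

Lemma ae_face p (S : {set 'I_3}) : Defs.nondegenerate p -> S != [set: 'I_3]%SET ->
  {ae mu2, forall x, ~ face p S x}.
Proof.
move=> nd ST; have [k kS] : exists k, k \notin S.
  apply/existsP; rewrite -negb_forall; apply: contra ST => /forallP h.
  by apply/eqP/setP => k; rewrite inE h.
apply: filterS (ae_bary nd) => x h [l [_ lS l1 xE]].
by have := h k; rewrite xE bary_comb// lS// eqxx.
Qed.

(** Boundaries of triangles and common faces are covered by finitely many lines
    on which a barycentric coordinate vanishes. *)
Lemma ae_triangulation U N (T : 'I_N -> 'I_3 -> R * R) : triangulation U T ->
  {ae mu2, forall x, U x -> exists i, (tri (T i))° x /\ forall j, j != i -> ~ tri (T j) x}.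
Proof.
move=> [nd clU conf].
have h1 : {ae mu2, forall x, forall i, tri (T i) x -> (tri (T i))° x}.
  by apply: filter_forall => i; exact: ae_tri_interior.
have h2 : {ae mu2, forall x, forall i j, i != j -> ~ (tri (T i) x /\ tri (T j) x)}.
  apply: filter_forall => i; apply: filter_forall => j.
  have [->|ij] := eqVneq i j; first exact: aeW.
  have [S [S' [ST _ E _]]] := conf i j ij.
  apply: filterS (ae_face (nd i) ST) => x h _ hij; apply: h.
  by rewrite -E.
apply: filterS2 h1 h2 => x h1 h2 Ux.
have : closure U x by exact: subset_closure.
rewrite clU => -[i _ ti]; exists i; split; first exact: h1.
by move=> j ji tj; exact: (h2 j i ji).
Qed.

(** A point [x] of an open triangle outside [U] would be a boundary point.  In the
    local frame at [x], points slightly below the graph are interior to the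
    complement of [U], whereas they belong to the triangle and thus to the
    closure of [U]. *)
Lemma tri_sub_domain U N (T : 'I_N -> 'I_3 -> R * R) i :
  polygonal_lipschitz_domain U -> triangulation U T -> (tri (T i))° `<=` U.
Proof.
move=> [oU _ _ _ [lip _]] [nd clU _] x xi; apply: contrapT => Ux.
have tcl : tri (T i) `<=` closure U by rewrite clU => y ty; exists i.
have frx : frontier U x.
  split; first by apply: tcl; exact: interior_subset.
  by move=> /interior_subset.
have [c [s [k [r [h [gamma [cs r0 h0 gk hU]]]]]]] := lip x frx.
have g0 : 0 <= gamma 0.
  rewrite leNgt; apply/negP => g0; apply: Ux.
  have := (hU 0 0); rewrite normr0 => /(_ r0 h0); rewrite !scale0r !addr0.
  by case=> _; apply.
have /nbhs_ballP[e /= e0 eT] : nbhs x (tri (T i)) by [].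
(* [z], at depth [dl] below the graph, stays in the ball of radius [e] and in
   the frame of height [h]; the radius [eta] around [z] is so small that the
   Lipschitz graph cannot descend to it. *)
pose dl := Num.min e h / 3.
have m0 : 0 < Num.min e h by rewrite lt_min e0.
have dl0 : 0 < dl by rewrite divr_gt0.
have dle : dl < e.
  apply: (@lt_le_trans _ _ (Num.min e h)); last by rewrite ge_min lexx.
  by rewrite /dl; lra.
have dlh : dl * 3 <= h by rewrite /dl divfK ?ge_min ?lexx ?orbT// pnatr_eq0.
have k0 : 0 < 1 + `|k| by rewrite ltr_pwDl.
pose eta := Num.min (r / 3) (dl / (2 * (1 + `|k|))).
have eta0 : 0 < eta by rewrite lt_min !divr_gt0// mulr_gt0.
have etar : 2 * eta < r.
  have : eta <= r / 3 by rewrite ge_min lexx.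
  by lra.
have etad : 2 * eta + `|k| * (2 * eta) <= dl.
  have : eta <= dl / (2 * (1 + `|k|)) by rewrite ge_min lexx orbT.
  by rewrite ler_pdivlMr ?mulr_gt0//; nra.
have c1 : `|c| <= 1 by rewrite -(@ler_sqr _ `|c|) ?nnegrE// real_normK ?num_real//; nra.
have s1 : `|s| <= 1 by rewrite -(@ler_sqr _ `|s|) ?nnegrE// real_normK ?num_real//; nra.
pose z := x + (- dl) *: (- s, c).
have zcl : closure U z.
  apply: tcl; apply: eT; split; rewrite /ball /=.
    rewrite opprD addrA subrr add0r normrN /GRing.scale /= mulrNN normrM gtr0_norm//.
    by apply: le_lt_trans dle; rewrite ler_piMr// ltW.
  rewrite opprD addrA subrr add0r normrN /GRing.scale /= mulNr normrN normrM gtr0_norm//.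
  by apply: le_lt_trans dle; rewrite ler_piMr// ltW.
have [w [Uw [w1 w2]]] := zcl _ (nbhsx_ballx z eta eta0).
pose t := (w.1 - x.1) * c + (w.2 - x.2) * s.
pose y := (w.2 - x.2) * c - (w.1 - x.1) * s.
have wE : w = x + t *: (c, s) + y *: (- s, c).
  rewrite /t /y; case: (w) (x) => [w1' w2'] [x1 x2]; congr pair; rewrite /= /GRing.scale /=.
    transitivity (x1 + (w1' - x1) * (c ^+ 2 + s ^+ 2)); first by rewrite cs; ring.
    by ring.
  transitivity (x2 + (w2' - x2) * (c ^+ 2 + s ^+ 2)); first by rewrite cs; ring.
  by ring.
have tE : t = - ((z.1 - w.1) * c + (z.2 - w.2) * s).
  by rewrite /t /z /= /GRing.scale /=; ring.
have yE : y + dl = - ((z.2 - w.2) * c - (z.1 - w.1) * s).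
  have {1}-> : dl = dl * (c ^+ 2 + s ^+ 2) by rewrite cs mulr1.
  by rewrite /y /z /= /GRing.scale /=; ring.
have w1c (q : R) : `|q| <= 1 -> `|(z.1 - w.1) * q| <= eta.
  move=> q1; rewrite normrM -[leRHS]mulr1 ler_pM//.
  by rewrite ltW.
have w2c (q : R) : `|q| <= 1 -> `|(z.2 - w.2) * q| <= eta.
  move=> q1; rewrite normrM -[leRHS]mulr1 ler_pM//.
  by rewrite ltW.
have t2 : `|t| <= 2 * eta.
  rewrite tE normrN (le_trans (ler_normD _ _))//.
  by have := w1c c c1; have := w2c s s1; lra.
have y2 : `|y + dl| <= 2 * eta.
  rewrite yE normrN (le_trans (ler_normB _ _))//.
  by have := w1c s s1; have := w2c c c1; lra.
move: y2; rewrite ler_norml => /andP[y2 y3].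
have kt : 0 <= `|k| * (2 * eta) by rewrite mulr_ge0// mulr_ge0// ltW.
have := hU t y; rewrite -wE (le_lt_trans t2)// => /(_ isT).
have yh : `|y| < h by rewrite ltr_norml; apply/andP; split; lra.
move=> /(_ yh)[/(_ Uw) + _]; apply/negP; rewrite -leNgt.
have := gk 0 t; rewrite sub0r normrN => gt.
have : k * `|t| <= `|k| * (2 * eta).
  apply: (@le_trans _ _ (`|k| * `|t|)); first by rewrite ler_wpM2r// ler_norm.
  by rewrite ler_wpM2l.
have := ler_norm (gamma 0 - gamma t); lra.
Qed.

Lemma enorm_le x : enorm x <= `|x.1| + `|x.2|.
Proof.
rewrite /enorm -[leRHS]ger0_norm ?addr_ge0// -sqrtr_sqr; apply: ler_wsqrtr.
rewrite sqrrD !real_normK ?num_real//.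
by have : 0 <= `|x.1| * `|x.2| by []; rewrite mulr2n; lra.
Qed.

Lemma tri_bounded p x : tri p x ->
  `|x.1| <= \sum_k `|(p k).1| /\ `|x.2| <= \sum_k `|(p k).2|.
Proof.
move=> [l [l0 _ l1 ->]].
have lk k : l k <= 1.
  by rewrite -l1 (bigD1 k)//= lerDl sumr_ge0.
have E1 : (\sum_k l k *: p k).1 = \sum_k l k * (p k).1 by rewrite !sum3.
have E2 : (\sum_k l k *: p k).2 = \sum_k l k * (p k).2 by rewrite !sum3.
by rewrite E1 E2; split; (apply: le_trans (ler_norm_sum _ _ _) _; apply: ler_sum => k _;
  rewrite normrM ler_piMl// ger0_norm).
Qed.

Lemma diam_tri_gt0 p : Defs.nondegenerate p -> 0 < diam (tri p).
Proof.
move=> nd; pose E := [set d | exists x y, [/\ tri p x, tri p y & d = enorm (x - y)]].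
have pin j : tri p (p j).
  exists (fun k => (k == j)%:R); split=> //.
  - by move=> k; rewrite inE.
  - by rewrite (bigD1 j)//= eqxx big1 ?addr0// => i /negbTE ->.
  - by rewrite (bigD1 j)//= eqxx scale1r big1 ?addr0// => i /negbTE ->; rewrite scale0r.
have Ep : E (enorm (p (inord 1) - p (inord 0))) by exists (p (inord 1)), (p (inord 0)).
have ubE : has_ubound E.
  exists (2 * (\sum_k `|(p k).1| + \sum_k `|(p k).2|)) => _ [x [y [/tri_bounded[x1 x2]
    /tri_bounded[y1 y2] ->]]].
  apply: le_trans (enorm_le _) _ => /=.
  have := ler_normB x.1 y.1; have := ler_normB x.2 y.2; lra.
apply: lt_le_trans (ub_le_sup ubE Ep).
rewrite /enorm sqrtr_gt0 lt0r addr_ge0 ?sqr_ge0// andbT.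
apply: contra nd; rewrite paddr_eq0 ?sqr_ge0// !sqrf_eq0 => /andP[/eqP -> /eqP ->].
by rewrite !mul0r subrr.
Qed.

Lemma meshsize_bounds U N (T : 'I_N -> 'I_3 -> R * R) : triangulation U T ->
  exists c C : R, 0 < c /\ {ae mu2, forall x, U x -> c <= meshsize T x <= C}.
Proof.
move=> trT; have [nd _ _] := trT.
have dg i : 0 < diam (tri (T i)) := diam_tri_gt0 (nd i).
exists (\big[Num.min/1]_i diam (tri (T i))), (\sum_i diam (tri (T i))); split.
  by elim/big_ind : _ => // a b a0 b0; rewrite lt_min a0.
apply: filterS (ae_triangulation trT) => x h Ux; have [i [xi _]] := h Ux.
rewrite /meshsize; apply/andP; split; last first.
  apply: ler_sum => j _; rewrite ler_piMr//; exact: ltW.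
have xE : \1_((tri (T i))°) x = 1 :> R by rewrite indicE mem_set.
rewrite [leRHS](bigD1 i)// [X in _ <= X + _](congr1 (fun t => _ * t) xE) mulr1.
apply: le_trans (_ : diam (tri (T i)) <= _); first by exact: bigmin_le_cond.
rewrite lerDl sumr_ge0// => j _; rewrite mulr_ge0//; exact: ltW.
Qed.

End Triangles.

(** * Weak derivatives of polynomials *)

Section PolynomialDerivatives.
Variable R : realType.
Local Notation mu2 := (@lebesgue_measure R \x @lebesgue_measure R)%E.
Local Notation plane := (measurableTypeR R * measurableTypeR R)%type.
Implicit Types (U K : set (R * R)) (f g v w : R * R -> R) (s : seq 'I_2).

Lemma sum_funE (I : Type) (r : seq I) (P : pred I) (F : I -> R * R -> R) x :
  (\sum_(i <- r | P i) F i) x = \sum_(i <- r | P i) F i x.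
Proof. exact: (big_morph (fun f : R * R -> R => f x)). Qed.

Lemma continuous_coord_line i (z : R * R) : continuous (coord_line i z).
Proof.
have [i0|i0] := eqVneq i ord0.
  have -> : coord_line i z = (fun t => (t, z.2)).
    by apply/funext => t; rewrite /coord_line i0.
  by move=> t; apply: (@cvg_pair _ _ _ (nbhs t) (nbhs t) (nbhs z.2) _ _ _ id (cst z.2));
    [exact: cvg_id|exact: cvg_cst].
have -> : coord_line i z = (fun t => (z.1, t)).
  by apply/funext => t; rewrite /coord_line (negbTE i0).
by move=> t; apply: (@cvg_pair _ _ _ (nbhs t) (nbhs z.1) (nbhs t) _ _ _ (cst z.1) id);
  [exact: cvg_cst|exact: cvg_id].
Qed.

Lemma integral_derive_compact (f df : R -> R) (M : R) : 0 < M ->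
  (forall x : R, is_derive x 1 f (df x)) -> continuous df ->
  (forall x, M <= `|x| -> f x = 0) -> (forall x, M <= `|x| -> df x = 0) ->
  (\int[@lebesgue_measure R]_x (df x)%:E = 0)%E.
Proof.
move=> M0 fdf cdf f0 df0.
have -> : (\int[@lebesgue_measure R]_x (df x)%:E =
           \int[@lebesgue_measure R]_(x in `[(- M)%R, M]) (df x)%:E)%E.
  rewrite [RHS]integral_mkcond; apply: eq_integral => x _; rewrite patchE.
  case: ifPn => //; rewrite notin_setE /= in_itv /= -ler_norml => /negP.
  by rewrite -ltNge => /ltW/df0 ->.
have cf : continuous f.
  by move=> x; apply: differentiable_continuous; apply/derivable1_diffP; have [] := fdf x.
rewrite (@continuous_FTC2 _ df f).
- by rewrite !f0 ?normrN ?ler_norm// subee.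
- by rewrite gtrN.
- exact: continuous_subspaceT.
- split.
  + by move=> x _; have [] := fdf x.
  + by apply: cvg_at_right_filter; exact: cf.
  + by apply: cvg_at_left_filter; exact: cf.
- by move=> x _; rewrite derive1E; have [_ ->] := fdf x.
Qed.

(** Fubini's theorem, integrating first along the lines of direction [edir i],
    on which the fundamental theorem of calculus applies. *)
Lemma int2_derive_compact K i f df : compact K -> continuous df ->
  (forall z, is_derive z (edir R i) f (df z)) ->
  (forall z, ~ K z -> f z = 0) -> (forall z, ~ K z -> df z = 0) ->
  int2 setT df = 0.
Proof.
move=> cK cdf fdf f0 df0.
have [M' KM'] := bounded_set_cbox (compact_bounded cK).
pose M := `|M'| + 1; have M0 : 0 < M by rewrite ltr_wpDl.
have KM z : K z -> `|z.1| < M /\ `|z.2| < M.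
  move=> /KM'; rewrite /cbox /= -!ler_norml => -[h1 h2].
  by split; [apply: le_lt_trans h1 _|apply: le_lt_trans h2 _]; rewrite /M;
    apply: le_lt_trans (ler_norm _) _; rewrite ltrDl.
have zK z : (M <= `|z.1|) || (M <= `|z.2|) -> ~ K z.
  by move=> h /KM[h1 h2]; move: h; rewrite !leNgt h1 h2.
have dfi : mu2.-integrable setT (EFin \o df).
  have L : inL2 (cbox (- M) M (- M) M) df.
    by apply: inL2_compact_support df0 => //; exact: measurable_cbox.
  have mQ := @measurable_cbox R (- M) M (- M) M.
  have /(integrable_mkcond _ mQ) := inL2_integrable mQ (mu_cbox_lty _ _ _ _) L.
  congr (integrable _ _ _); apply/funext => z; rewrite patchE.
  case: ifPn => //; rewrite notin_setE /cbox /= -!ler_norml => /not_andP h.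
  rewrite df0//; apply: zK; case: h => /negP; rewrite -ltNge => /ltW ->//.
  by rewrite orbT.
rewrite /int2 /Rintegral.
have line z : forall t : R, is_derive t 1 (f \o coord_line i z) (df (coord_line i z t)).
  move=> t; have := (is_derive_edir i f (coord_line i z t) (df (coord_line i z t))).2 (fdf _).
  by rewrite /coord_line /coord; case: (i == ord0).
suff h : forall z, (\int[@lebesgue_measure R]_t (df (coord_line i z t))%:E = 0)%E.
  have [i0|i0] := eqVneq i ord0.
    rewrite [X in fine X](_ : _ = 0%E)//.
    apply: (eq_trans (esym (integral21_prod_meas1 dfi))).
    apply: integral0_eq => y _.
    by have := h (0, y); rewrite i0.
  rewrite [X in fine X](_ : _ = 0%E)//.
  apply: (eq_trans (esym (integral12_prod_meas1 dfi))).
  apply: integral0_eq => x _.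
  by have := h (x, 0); rewrite /coord_line (negbTE i0).
move=> z; apply: (@integral_derive_compact (f \o coord_line i z) _ M) => //.
- by move=> t; apply: continuous_comp; [exact: continuous_coord_line|exact: cdf].
- by move=> t tM; apply: f0; apply: zK; rewrite /coord_line; case: ifP => _ /=; rewrite tM ?orbT.
- by move=> t tM; apply: df0; apply: zK; rewrite /coord_line; case: ifP => _ /=; rewrite tM ?orbT.
Qed.

Lemma inL2_continuous U f : @measurable _ plane U -> bounded_set U -> continuous f ->
  inL2 U f.
Proof.
move=> mU bU cf; have [M UM] := bounded_set_cbox bU.
have [B [_ hB]] : bounded_set (f @` cbox (- M) M (- M) M).
  apply: compact_bounded; apply: continuous_compact; last exact: compact_cbox.
  exact: continuous_subspaceT.
apply: (@inL2_bounded _ _ _ (B + 1)) => //.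
- exact: mu_bounded_lty.
- by apply: measurable_funTS; exact: continuous_measurable2.
- by move=> x Ux; apply: hB; rewrite ?ltrDl//; exists x => //; exact: UM.
Qed.

(** The product of [p] with the test function vanishes outside a compact subset of
    [U], so its derivative has integral 0 over the whole plane. *)
Lemma integration_by_parts2 U i (p dp f : R * R -> R) (t : seq 'I_2) : open U -> bounded_set U ->
  continuous p -> continuous dp -> (forall z, is_derive z (edir R i) p (dp z)) ->
  test_function U f ->
  int2 U (fun x => p x * pderiv (i :: t) f x) = - int2 U (fun x => dp x * pderiv t f x).
Proof.
move=> oU bU cp cdp pdp tf; have mU := open_measurable2 oU.
have [ct [K [cK KU t0]]] := test_pderiv t tf.
have [cit _] := test_pderiv (i :: t) tf.
have cl : closed K by apply: compact_closed => //; exact: norm_hausdorff.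
have it0 x : ~ K x -> pderiv (i :: t) f x = 0.
  exact: (@pderiv_support _ K (pderiv t f) [:: i]).
have Lp := inL2_continuous mU bU cp; have Ldp := inL2_continuous mU bU cdp.
have Lt := test_inL2 t mU tf; have Lit := test_inL2 (i :: t) mU tf.
pose dF x := 1 * (p x * pderiv (i :: t) f x) + dp x * pderiv t f x.
have dF0 : int2 setT dF = 0.
  apply: (@int2_derive_compact K i (p * pderiv t f)) => //.
  - move=> x; apply: (@continuousD _ _ _ (fun x => 1 * (p x * pderiv (i :: t) f x))
                        (fun x => dp x * pderiv t f x)).
      apply: (@continuousM _ _ (cst 1) (fun x => p x * pderiv (i :: t) f x)).
        exact: cst_continuous.
      by apply: continuousM; [exact: cp|exact: cit].
    by apply: continuousM; [exact: cdp|exact: ct].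
  - move=> z; have dt : is_derive z (edir R i) (pderiv t f) (pderiv (i :: t) f z).
      by apply: derivableP; have [_] := tf.1 t; apply.
    apply: (is_derive_eq (is_deriveM (pdp z) dt)).
    by rewrite /dF mul1r /GRing.scale /= [dp z * _]mulrC.
  - by move=> z /t0 h; rewrite mulrfctE h mulr0.
  - by move=> z Kz; rewrite /dF it0// t0// !mulr0 addr0.
have : int2 U dF = 0.
  rewrite -(@int2_sub _ U setT)//.
  move=> x Ux; have Kx : ~ K x by move=> /KU.
  by rewrite /dF it0// t0// !mulr0 addr0.
rewrite (int2_lincomb 1 mU (inL2_mul mU Lp Lit) (inL2_mul mU Ldp Lt)) mul1r => /eqP.
by rewrite addr_eq0 => /eqP.
Qed.

Definition monomial (a b : nat) : R * R -> R := tensor_fun (fun x => x ^+ a) (fun x => x ^+ b).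

Lemma is_derive_pow (a : nat) (x : R) : is_derive x 1 (fun t : R => t ^+ a) (a%:R * x ^+ a.-1).
Proof.
have -> : (fun t : R => t ^+ a) = id ^+ a by apply/funext => t; rewrite exprfctE.
by apply: (is_derive_eq (is_deriveX a (is_derive_id x 1))); rewrite /GRing.scale /= mulr1.
Qed.

Lemma continuous_pow (a : nat) : continuous (fun t : R => t ^+ a).
Proof.
move=> x; apply: differentiable_continuous; apply/derivable1_diffP.
by have [] := is_derive_pow a x.
Qed.

Lemma continuous_monomial a b : continuous (monomial a b).
Proof. by apply: continuous_tensor; exact: continuous_pow. Qed.

(** Integration by parts moves the derivatives onto the monomial one at a time, the
    outermost one first. *)
Lemma weak_monomial U s a b : open U -> bounded_set U ->
  exists2 w, continuous w & is_weak_derivative U s (monomial a b) w.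
Proof.
move=> oU bU; have mU := open_measurable2 oU.
elim: s a b => [|i s ih] a b.
  exists (monomial a b); first exact: continuous_monomial.
  by move=> f tf; rewrite expr0 mul1r.
pose c : R := if i == ord0 then a%:R else b%:R.
pose a' := if i == ord0 then a.-1 else a; pose b' := if i == ord0 then b else b.-1.
have [w cw hw] := ih a' b'.
have cc (g : R * R -> R) : continuous g -> continuous (fun x => c * g x).
  move=> cg x; apply: (@continuousM _ _ (cst c) g); first exact: cst_continuous.
  exact: cg.
have dm z : is_derive z (edir R i) (monomial a b) (c * monomial a' b' z).
  apply: (is_derive_eq (is_derive_tensor i z (is_derive_pow a) (is_derive_pow b))).
  by rewrite /c /a' /b' /monomial /tensor_fun; case: ifP => _; ring.
exists (fun x => c * w x); first exact: cc.
move=> f tf.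
rewrite (integration_by_parts2 s oU bU (@continuous_monomial a b)
   (cc _ (@continuous_monomial a' b')) dm tf).
have E (g h : R * R -> R) : continuous g -> inL2 U h ->
   int2 U (fun x => c * g x * h x) = c * int2 U (fun x => g x * h x).
  move=> cg Lh; rewrite /int2 -RintegralZl//.
    by apply: eq_Rintegral => x _; rewrite mulrA.
  by apply: inL2_mul => //; exact: inL2_continuous.
rewrite (E _ (pderiv s f)) ?(E w f)//; last 3 first.
- exact: (test_inL2 [::] mU tf).
- exact: continuous_monomial.
- exact: (test_inL2 s mU tf).
by rewrite hw// exprS; ring.
Qed.

Definition weakly_smooth U v := inL2 U v /\ forall s, has_wderiv U s v.

Lemma weakly_smooth_lincomb U a v1 v2 : @measurable _ plane U ->
  weakly_smooth U v1 -> weakly_smooth U v2 -> weakly_smooth U (lincomb a v1 v2).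
Proof.
move=> mU [L1 h1] [L2 h2]; split; first exact: inL2_lincomb.
by move=> s; exact: has_wderiv_lincomb.
Qed.

Lemma weakly_smooth_monomial U a b : open U -> bounded_set U ->
  weakly_smooth U (monomial a b).
Proof.
move=> oU bU; have mU := open_measurable2 oU.
split; first by apply: inL2_continuous => //; exact: continuous_monomial.
move=> s; have [w cw hw] := weak_monomial s a b oU bU.
by exists w; split=> //; exact: inL2_continuous.
Qed.

Lemma weakly_smooth_poly2 U k c : open U -> bounded_set U -> weakly_smooth U (poly2 k c).
Proof.
move=> oU bU; have mU := open_measurable2 oU.
have m0 := weakly_smooth_monomial 0 0 oU bU.
have h0 : weakly_smooth U 0.
  have -> : 0 = lincomb (-1) (monomial 0 0) (monomial 0 0).
    by apply/funext => x; rewrite /lincomb mulN1r addNr.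
  exact: weakly_smooth_lincomb.
have hD f g : weakly_smooth U f -> weakly_smooth U g -> weakly_smooth U (f + g).
  move=> hf hg; have -> : f + g = lincomb 1 f g.
    by apply/funext => x; rewrite /lincomb mul1r.
  exact: weakly_smooth_lincomb.
have -> : poly2 k c = \sum_(i < k.+1) \sum_(j < k.+1 | (i + j <= k)%N)
    (fun x => c i j * x.1 ^+ i * x.2 ^+ j).
  by apply/funext => x; rewrite /poly2 sum_funE; apply: eq_bigr => i _; rewrite sum_funE.
apply: (big_ind (weakly_smooth U)) => // i _.
apply: (big_ind (weakly_smooth U)) => // j _.
have -> : (fun x => c i j * x.1 ^+ i * x.2 ^+ j) = lincomb (c i j) (monomial i j) 0.
  by apply/funext => x; rewrite /lincomb /monomial /tensor_fun addr0 mulrA.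
by apply: weakly_smooth_lincomb => //; exact: weakly_smooth_monomial.
Qed.

Lemma weakly_smooth_eq U v v' : (forall x, U x -> v x = v' x) ->
  weakly_smooth U v -> weakly_smooth U v'.
Proof.
move=> vv [Lv hv]; split.
  move: Lv; rewrite /inL2 (_ : v \_ U = v' \_ U)//.
  by apply/funext => x; rewrite !patchE; case: ifPn => // /set_mem /vv.
move=> s; have [w [Lw hw]] := hv s; exists w; split=> // f tf; rewrite -hw//.
by apply: eq_int2 => x Ux; rewrite vv.
Qed.

End PolynomialDerivatives.

(** * Piecewise weak derivatives *)

Section BrokenSobolev.
Variable R : realType.
Local Notation mu2 := (@lebesgue_measure R \x @lebesgue_measure R)%E.
Local Notation plane := (measurableTypeR R * measurableTypeR R)%type.
Variables (U : set (R * R)) (N : nat) (T : 'I_N -> 'I_3 -> R * R).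
Hypotheses (oU : open U) (bU : bounded_set U) (trT : triangulation U T).
Hypothesis subT : forall i, (tri (T i))° `<=` U.

Local Notation mU := (open_measurable2 oU).

Let oT i : open (tri (T i))° := @open_interior _ (tri (T i)).

Let mT i : @measurable _ plane (tri (T i))°.
Proof. exact: open_measurable2. Qed.

(** [Dpw] is [glue] applied to the weak derivatives on the single triangles. *)
Definition glue (w : 'I_N -> R * R -> R) (x : R * R) : R :=
  \sum_i (w i \_ (tri (T i))°) x.

Lemma inL2_glue w : (forall i, inL2 (tri (T i))° (w i)) -> inL2 U (glue w).
Proof.
move=> Lw; have m0 : @measurable _ plane setT by exact: measurableT.
have L0 : inL2 setT (0 : R * R -> R).
  by apply: (@inL2_compact_support _ set0) => //; [exact: compact0|exact: cst_continuous].
apply: (@inL2_sub _ U setT) => //; first exact: mU.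
have -> : glue w = \sum_i (w i \_ (tri (T i))°).
  by apply/funext => x; rewrite sum_funE.
apply: (big_ind (inL2 setT)) => [//|f g Lf Lg|i _].
  have -> : f + g = lincomb 1 f g by apply/funext => x; rewrite /lincomb mul1r.
  exact: inL2_lincomb.
by have := Lw i; rewrite /inL2 patch_setT.
Qed.

Lemma glueE w x i : (tri (T i))° x -> (forall j, j != i -> ~ tri (T j) x) ->
  glue w x = w i x.
Proof.
move=> xi xj; rewrite /glue (bigD1 i)//= patchE mem_set// big1 ?addr0// => j /xj tj.
rewrite patchE; case: ifPn => // /set_mem tj'; exfalso; apply: tj.
exact: interior_subset.
Qed.

Lemma glue_ae w h : (forall i, ae_eq_on (tri (T i))° (w i) h) -> ae_eq_on U (glue w) h.
Proof.
move=> wh; have wh' : {ae mu2, forall x, forall i, (tri (T i))° x -> w i x = h x}.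
  by apply: filter_forall => i; exact: wh.
apply: filterS2 wh' (ae_triangulation trT) => x h1 h2 Ux.
have [i [xi xj]] := h2 Ux.
by rewrite (glueE w xi xj) h1.
Qed.

Lemma ae_eq_on_sub V W (f g : R * R -> R) : V `<=` W -> ae_eq_on W f g -> ae_eq_on V f g.
Proof. by move=> VW; apply: filterS => x h /VW. Qed.

(** A common linear space for the conforming and the discrete functions on which
    [Dpw] of order [m] is square integrable and linear up to null sets. *)
Definition broken_sobolev m (v : R * R -> R) :=
  inL2 U v /\ forall i (al : seq 'I_2), size al = m -> has_wderiv (tri (T i))° al v.

Lemma inL2_tri i v : inL2 U v -> inL2 (tri (T i))° v.
Proof. by apply: inL2_sub; [exact: mU|exact: mT|exact: subT]. Qed.

Lemma broken_sobolev_lincomb m a v1 v2 : broken_sobolev m v1 -> broken_sobolev m v2 ->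
  broken_sobolev m (lincomb a v1 v2).
Proof.
move=> [L1 h1] [L2 h2]; split; first exact: inL2_lincomb.
move=> i al alm; apply: has_wderiv_lincomb; [exact: mT|exact: inL2_tri|exact: inL2_tri|
  exact: h1|exact: h2].
Qed.

Lemma inL2_Dpw m v (al : m.-tuple 'I_2) : broken_sobolev m v -> inL2 U (Dpw T v al).
Proof.
by move=> [_ hv]; apply: inL2_glue => i; have [] := wderivP (hv i al (size_tuple al)).
Qed.

Lemma Dpw_lincomb m a v1 v2 (al : m.-tuple 'I_2) :
  broken_sobolev m v1 -> broken_sobolev m v2 ->
  ae_eq_on U (Dpw T (lincomb a v1 v2) al) (lincomb a (Dpw T v1 al) (Dpw T v2 al)).
Proof.
move=> [L1 h1] [L2 h2].
have h : {ae mu2, forall x, forall i, (tri (T i))° x ->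
    wderiv (tri (T i))° al (lincomb a v1 v2) x =
    lincomb a (wderiv (tri (T i))° al v1) (wderiv (tri (T i))° al v2) x}.
  apply: filter_forall => i; apply: wderiv_lincomb; [exact: oT|exact: inL2_tri|
    exact: inL2_tri|exact: h1 (size_tuple al)|exact: h2 (size_tuple al)].
apply: filterS h => x h _.
rewrite /lincomb /Dpw mulr_sumr -big_split; apply: eq_bigr => i _ /=.
rewrite !patchE; case: ifPn => [/set_mem xi|_]; last by rewrite mulr0 addr0.
by rewrite h.
Qed.

Lemma Dpw_ae m v v' (al : m.-tuple 'I_2) : inL2 U v -> inL2 U v' -> ae_eq_on U v v' ->
  Dpw T v al = Dpw T v' al.
Proof.
move=> Lv Lv' vv; apply/funext => x; rewrite /Dpw; apply: eq_bigr => i _.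
congr ((_ \_ _) x); apply: wderiv_ae; [exact: mT|exact: inL2_tri|exact: inL2_tri|].
exact: ae_eq_on_sub vv.
Qed.

Lemma sobolev_broken m v : sobolev m U v -> broken_sobolev m v.
Proof.
move=> [Lv hv]; split=> // i al alm.
have hal : has_wderiv U al v by apply: hv; rewrite alm.
by have [] := wderiv_sub oU (@oT i) (@subT i) hal.
Qed.

Lemma Dpw_Dm m v (al : m.-tuple 'I_2) : sobolev m U v ->
  ae_eq_on U (Dpw T v al) (Dm U v al).
Proof.
move=> [Lv hv]; apply: glue_ae => i.
have hal : has_wderiv U al v by apply: hv; rewrite size_tuple.
by have [] := wderiv_sub oU (@oT i) (@subT i) hal.
Qed.

Lemma pwpoly_tri k v i : pwpoly k U T v -> weakly_smooth (tri (T i))° v.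
Proof.
move=> [_ /(_ i)[c vc]].
have bT : bounded_set (tri (T i))° 
  by case: bU => M [Mr h]; exists M; split=> // t Mt y /subT; exact: h.
by apply: weakly_smooth_eq (weakly_smooth_poly2 k c (@oT i) bT) => x /vc ->.
Qed.

(** Only the values off the skeleton are polynomial; measurability of [v] allows
    replacing it by the function glued from its restrictions. *)
Lemma pwpoly_inL2 k v : pwpoly k U T v -> inL2 U v.
Proof.
move=> pv; have [mv _] := pv.
apply: (@inL2_ae _ U (glue (fun=> v))); first exact: mU.
- exact: mv.
- by apply: glue_ae => i; exact: ae_eq_on_refl.
- by apply: inL2_glue => i; have [] := pwpoly_tri i pv.
Qed.

Lemma pwpoly_broken k m v : pwpoly k U T v -> broken_sobolev m v.
Proof.
move=> pv; split; first exact: pwpoly_inL2 pv.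
by move=> i al _; have [_] := pwpoly_tri i pv; apply.
Qed.

End BrokenSobolev.

(** * The L2 product of tensor fields *)

Section Tensors.
Variable R : realType.
Local Notation mu2 := (@lebesgue_measure R \x @lebesgue_measure R)%E.
Local Notation plane := (measurableTypeR R * measurableTypeR R)%type.
Variables (m : nat) (U : set (R * R)).
Hypothesis mU : @measurable _ plane U.
Implicit Types (G H : tensor R m).

Definition tensorL2 G : Prop := forall al, inL2 U (G al).

Definition tlincomb a G H : tensor R m := fun al => lincomb a (G al) (H al).

Lemma tensorL2_lincomb a G H : tensorL2 G -> tensorL2 H -> tensorL2 (tlincomb a G H).
Proof. by move=> LG LH al; exact: inL2_lincomb. Qed.

Lemma tdot_integrable G H : tensorL2 G -> tensorL2 H ->
  mu2.-integrable U (EFin \o (fun x => \sum_al G al x * H al x)).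
Proof.
move=> LG LH; have -> : EFin \o (fun x => \sum_al G al x * H al x) =
    (fun x => \sum_(al : m.-tuple 'I_2) (G al x * H al x)%:E)%E.
  by apply/funext => x /=; rewrite sumEFin.
by apply: integrable_sum => // al _; exact: inL2_mul.
Qed.

Lemma tdotC G H : tdot U G H = tdot U H G.
Proof. by apply: eq_int2 => x _; apply: eq_bigr => al _; rewrite mulrC. Qed.

Lemma tdot_lincombl a G1 G2 H : tensorL2 G1 -> tensorL2 G2 -> tensorL2 H ->
  tdot U (tlincomb a G1 G2) H = a * tdot U G1 H + tdot U G2 H.
Proof.
move=> L1 L2 LH; rewrite /tdot -int2_lincomb//; try exact: tdot_integrable.
apply: eq_int2 => x _; rewrite /lincomb mulr_sumr -big_split; apply: eq_bigr => al _ /=.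
by rewrite mulrDl mulrA.
Qed.

Lemma tdot_lincombr a G1 G2 H : tensorL2 G1 -> tensorL2 G2 -> tensorL2 H ->
  tdot U H (tlincomb a G1 G2) = a * tdot U H G1 + tdot U H G2.
Proof. by move=> L1 L2 LH; rewrite tdotC tdot_lincombl// ![tdot U H _]tdotC. Qed.

Lemma tdot_ae G G' H : tensorL2 G -> tensorL2 G' -> tensorL2 H ->
  (forall al, ae_eq_on U (G al) (G' al)) -> tdot U G H = tdot U G' H.
Proof.
move=> L L' LH GG; apply: int2_ae => //.
- by have [/measurable_EFinP] := integrableP _ _ _ (tdot_integrable L LH).
- by have [/measurable_EFinP] := integrableP _ _ _ (tdot_integrable L' LH).
- have h : {ae mu2, forall x, forall al, U x -> G al x = G' al x}.
    by apply: filter_forall => al; exact: GG.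
  by apply: filterS h => x h Ux; apply: eq_bigr => al _; rewrite h.
Qed.

Lemma tdot_ge0 G : 0 <= tdot U G G.
Proof. by apply: int2_ge0 => x _; apply: sumr_ge0 => al _; rewrite -expr2 sqr_ge0. Qed.

Lemma tdot_cauchy_schwarz G H : tensorL2 G -> tensorL2 H ->
  `|tdot U G H| <= tnorm U G * tnorm U H.
Proof.
move=> LG LH; apply: discriminant => t.
have L := tensorL2_lincomb t LH LG.
have := tdot_ge0 (tlincomb t H G).
rewrite tdot_lincombl// !tdot_lincombr// [tdot U H G]tdotC.
by congr (0 <= _); ring.
Qed.

End Tensors.

(** * Linearity of the space of functions with zero boundary values *)

Section SobolevZero.
Variable R : realType.
Local Notation mu2 := (@lebesgue_measure R \x @lebesgue_measure R)%E.
Local Notation plane := (measurableTypeR R * measurableTypeR R)%type.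
Implicit Types (U K : set (R * R)) (f g v w : R * R -> R) (s : seq 'I_2).

(** Minkowski's inequality, from the Cauchy-Schwarz inequality for the mixed term. *)
Lemma l2norm_lincomb U a f g : @measurable _ plane U -> inL2 U f -> inL2 U g ->
  l2norm U (lincomb a f g) <= `|a| * l2norm U f + l2norm U g.
Proof.
move=> mU Lf Lg; set F := l2norm U f; set G := l2norm U g.
have F0 : 0 <= F by exact: sqrtr_ge0.
have G0 : 0 <= G by exact: sqrtr_ge0.
have [_ fi] := (inL2P f mU).1 Lf; have [_ gi] := (inL2P g mU).1 Lg.
have fgi := inL2_mul mU Lf Lg.
have FE : int2 U (fun x => f x ^+ 2) = F ^+ 2.
  by rewrite sqr_sqrtr// int2_ge0// => x _; exact: sqr_ge0.
have GE : int2 U (fun x => g x ^+ 2) = G ^+ 2.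
  by rewrite sqr_sqrtr// int2_ge0// => x _; exact: sqr_ge0.
have i1 : mu2.-integrable U
    (EFin \o lincomb (2 * a) (fun x => f x * g x) (fun x => g x ^+ 2)).
  have := integrableD mU (integrableZl mU (2 * a) fgi) gi.
  by apply: eq_integrable.
have E : int2 U (fun x => lincomb a f g x ^+ 2) =
    a ^+ 2 * F ^+ 2 + (2 * a * int2 U (fun x => f x * g x) + G ^+ 2).
  rewrite -FE -GE -int2_lincomb// -int2_lincomb//.
  by apply: eq_int2 => x _; rewrite /lincomb; ring.
have aF0 : 0 <= `|a| * F + G by rewrite addr_ge0// mulr_ge0.
rewrite /l2norm E -[leRHS](ger0_norm aF0) -sqrtr_sqr; apply: ler_wsqrtr.
have -> : (`|a| * F + G) ^+ 2 = `|a| ^+ 2 * F ^+ 2 + (2 * (`|a| * (F * G)) + G ^+ 2).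
  by ring.
rewrite real_normK ?num_real// lerD2l lerD2r -mulrA ler_pM2l//.
apply: le_trans (ler_norm _) _; rewrite normrM ler_wpM2l//.
exact: int2_cauchy_schwarz.
Qed.

Lemma l2norm_ae U f g : @measurable _ plane U -> inL2 U f -> inL2 U g ->
  ae_eq_on U f g -> l2norm U f = l2norm U g.
Proof.
move=> mU Lf Lg fg; congr Num.sqrt; apply: int2_ae => //.
- by apply: measurable_funX; exact: inL2_measurable.
- by apply: measurable_funX; exact: inL2_measurable.
- by apply: filterS fg => x h Ux; rewrite h.
Qed.

Lemma pderiv_lincomb s a f g : smooth f -> smooth g ->
  pderiv s (lincomb a f g) = lincomb a (pderiv s f) (pderiv s g).
Proof.
move=> sf sg; elim: s => [//|i s ih]; apply/funext => z; rewrite /= ih.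
have [_ /(_ i z)/derivableP df] := sf s; have [_ /(_ i z)/derivableP dg] := sg s.
rewrite /lincomb -['D_(edir R i) (pderiv s f) z]/_.
have [_ h] := is_deriveD (is_deriveZ a df) dg.
by rewrite -[RHS]h.
Qed.

Lemma smooth_lincomb a f g : smooth f -> smooth g -> smooth (lincomb a f g).
Proof.
move=> sf sg s; rewrite pderiv_lincomb//; have [cf df] := sf s; have [cg dg] := sg s.
split.
  move=> x; apply: (@continuousD _ _ _ (fun x => a * pderiv s f x) (pderiv s g));
    last exact: cg.
  by apply: (@continuousM _ _ (cst a)); [exact: cst_continuous|exact: cf].
move=> i x; have := derivableD (@derivableZ _ _ _ _ a _ _ (df i x)) (dg i x); exact.
Qed.

Lemma test_lincomb U a f g : test_function U f -> test_function U g ->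
  test_function U (lincomb a f g).
Proof.
move=> [sf [K [cK KU f0]]] [sg [K' [cK' KU' g0]]]; split; first exact: smooth_lincomb.
exists (K `|` K'); split; first exact: compactU.
  by move=> x [/KU|/KU'].
by move=> x /not_orP[xK xK']; rewrite /lincomb f0// g0// mulr0 addr0.
Qed.

Lemma sobolev_lincomb m U a v w : @measurable _ plane U -> sobolev m U v ->
  sobolev m U w -> sobolev m U (lincomb a v w).
Proof.
move=> mU [Lv hv] [Lw hw]; split; first exact: inL2_lincomb.
by move=> s sm; apply: has_wderiv_lincomb => //; [exact: hv|exact: hw].
Qed.

(** The linear combinations of the approximating test functions converge, by the
    triangle inequality and the almost everywhere linearity of [wderiv]. *)
Lemma sobolev0_lincomb m U a v w : open U -> sobolev0 m U v -> sobolev0 m U w ->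
  sobolev0 m U (lincomb a v w).
Proof.
move=> oU [sv [f [tf cf]] contv] [sw [g [tg cg]] contw].
have mU := open_measurable2 oU.
split; first exact: sobolev_lincomb.
  exists (fun n => lincomb a (f n) (g n)); split.
    by move=> n; exact: test_lincomb.
  move=> s sm; have [Lv /(_ s sm) hv] := sv; have [Lw /(_ s sm) hw] := sw.
  have [Lwv _] := wderivP hv; have [Lww _] := wderivP hw.
  have subE (p q : R * R -> R) : p - q = lincomb (-1) q p.
    by apply/funext => x; rewrite /lincomb mulN1r addrC.
  have [Lwvw _] := wderivP (has_wderiv_lincomb a mU Lv Lw hv hw).
  apply: (@squeeze_cvgr _ _ _ _ (cst 0) (fun n =>
    `|a| * l2norm U (wderiv U s v - pderiv s (f n)) +
    l2norm U (wderiv U s w - pderiv s (g n)))); last 2 first.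
  - exact: cvg_cst.
  - rewrite -[X in _ --> X]addr0 -[X in _ --> X + _](mulr0 `|a|).
    apply: cvgD; last exact: cg.
    by apply: cvgM; [exact: cvg_cst|exact: cf].
  apply: nearW => n; rewrite sqrtr_ge0 /=.
  have Lf := test_inL2 s mU (tf n); have Lg := test_inL2 s mU (tg n).
  have L1 : inL2 U (wderiv U s v - pderiv s (f n)) by rewrite subE; exact: inL2_lincomb.
  have L2 : inL2 U (wderiv U s w - pderiv s (g n)) by rewrite subE; exact: inL2_lincomb.
  apply: le_trans (l2norm_lincomb a mU L1 L2).
  rewrite (@l2norm_ae _ _ (lincomb a (wderiv U s v - pderiv s (f n))
     (wderiv U s w - pderiv s (g n))))//.
  - rewrite subE pderiv_lincomb; [|by have [] := tf n|by have [] := tg n].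
    by apply: inL2_lincomb => //; exact: inL2_lincomb.
  - exact: inL2_lincomb.
  - rewrite pderiv_lincomb; [|by have [] := tf n|by have [] := tg n].
    apply: filterS (wderiv_lincomb a oU Lv Lw hv hw) => x h Ux.
    by have := h Ux; rewrite /lincomb !fctE => ->; ring.
move=> m2 x Ux.
apply: (@continuousD _ _ _ (fun x => a * v x) w); last exact: contw.
by apply: (@continuousM _ _ (cst a)); [exact: cst_continuous|exact: contv].
Qed.

End SobolevZero.

(** * Mesh-weighted norms *)

Section MeshWeights.
Variable R : realType.
Local Notation mu2 := (@lebesgue_measure R \x @lebesgue_measure R)%E.
Local Notation plane := (measurableTypeR R * measurableTypeR R)%type.

(** Clipping [f] at the levels [- |g|] and [|g|] changes it on a null set only. *)
Lemma inL2_le_ae (U : set (R * R)) (f g : R * R -> R) : @measurable _ plane U ->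
  measurable_fun (U : set plane) (f : plane -> R) ->
  {ae mu2, forall x, U x -> `|f x| <= `|g x|} -> inL2 U g -> inL2 U f.
Proof.
move=> mU mf fg Lg; have mg := inL2_measurable mU Lg.
have mg' : measurable_fun (U : set plane) ((fun x => `|g x|) : plane -> R).
  exact: measurableT_comp.
have mNg : measurable_fun (U : set plane) ((fun x => - `|g x|) : plane -> R).
  exact: measurableT_comp.
pose f' x := Num.min `|g x| (Num.max (- `|g x|) (f x)).
have Lf' : inL2 U f'.
  apply: (@inL2_le _ _ _ g) => //.
    by apply: measurable_minr => //; exact: measurable_maxr.
  move=> x _; rewrite /f' ler_norml le_min ge_min lexx /= andbT.
  by rewrite le_max lexx /= andbT (le_trans _ (normr_ge0 _))// oppr_le0.
apply: inL2_ae Lf' => //; apply: filterS fg => x h Ux.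
move: (h Ux); rewrite ler_norml /f' => /andP[h1 h2].
by rewrite (max_idPr h1) (min_idPr h2).
Qed.

Variables (U : set (R * R)) (N : nat) (T : 'I_N -> 'I_3 -> R * R).
Hypotheses (oU : open U) (trT : triangulation U T).

Lemma meshsize_ge0 x : 0 <= meshsize T x.
Proof.
apply: sumr_ge0 => i _; rewrite mulr_ge0//; apply: ltW; apply: diam_tri_gt0.
by have [nd _ _] := trT.
Qed.

Lemma measurable_meshsize : measurable_fun (setT : set plane) (meshsize T : plane -> R).
Proof.
rewrite /meshsize; apply: (@measurable_sum _ plane) => i.
apply: measurable_funM; first exact: measurable_cst.
by apply: measurable_indic; apply: open_measurable2; exact: open_interior.
Qed.

(** Off the null skeleton the mesh size lies between two positive constants, so
    the weights cancel and preserve square integrability. *)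
Lemma int2_weighted_cauchy_schwarz m (g r : R * R -> R) : inL2 U g -> inL2 U r ->
  int2 U (fun x => g x * r x) <=
  l2norm U (fun x => meshsize T x ^+ m * g x) *
  l2norm U (fun x => meshsize T x ^- m * r x).
Proof.
move=> Lg Lr; have mU := open_measurable2 oU.
have [c [C [c0 hcC]]] := meshsize_bounds trT.
have mh : measurable_fun (U : set plane) (meshsize T : plane -> R).
  by apply: measurable_funTS; exact: measurable_meshsize.
have mV : measurable_fun (U : set plane) ((fun x => meshsize T x ^- m) : plane -> R).
  have -> : (fun x => meshsize T x ^- m) = (fun x => meshsize T x `^ (- m%:R)).
    by apply/funext => x; rewrite powR_invn// meshsize_ge0.
  by apply: (@measurableT_comp _ _ _ plane _ _ (fun t : R => t `^ (- m%:R))).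
have scale k (f : R * R -> R) : inL2 U f -> inL2 U (fun x => k * f x).
  move=> Lf; have -> : (fun x => k * f x) = lincomb (k - 1) f f.
    by apply/funext => x; rewrite /lincomb; ring.
  exact: inL2_lincomb.
have L1 : inL2 U (fun x => meshsize T x ^+ m * g x).
  apply: (@inL2_le_ae _ _ (fun x => C ^+ m * g x)) => //; last exact: scale.
    by apply: measurable_funM; [exact: measurable_funX|exact: inL2_measurable].
  apply: filterS hcC => x h Ux; have /andP[h1 h2] := h Ux.
  rewrite !normrM ler_wpM2r// !ger0_norm ?exprn_ge0 ?meshsize_ge0//.
    by rewrite lerXn2r ?nnegrE ?meshsize_ge0// (le_trans _ h2)// meshsize_ge0.
  by rewrite (le_trans _ h2)// meshsize_ge0.
have L2 : inL2 U (fun x => meshsize T x ^- m * r x).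
  apply: (@inL2_le_ae _ _ (fun x => c ^- m * r x)) => //; last exact: scale.
    by apply: measurable_funM => //; exact: inL2_measurable.
  apply: filterS hcC => x h Ux; have /andP[h1 h2] := h Ux.
  have h0 : 0 < meshsize T x := lt_le_trans c0 h1.
  have c0' := ltW c0; have h0' := ltW h0.
  rewrite !normrM ler_wpM2r// !ger0_norm ?invr_ge0 ?exprn_ge0//.
  by rewrite lef_pV2 ?posrE ?exprn_gt0// lerXn2r ?nnegrE.
apply: le_trans (int2_cauchy_schwarz mU L1 L2); apply: le_trans (ler_norm _).
rewrite (@int2_ae _ U _ (fun x => meshsize T x ^+ m * g x * (meshsize T x ^- m * r x)))//.
- by apply: measurable_funM; exact: inL2_measurable.
- by apply: measurable_funM; exact: inL2_measurable.
- apply: filterS hcC => x h Ux; have /andP[h1 h2] := h Ux.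
  have h0 : meshsize T x ^+ m != 0 by rewrite expf_neq0// gt_eqF// (lt_le_trans c0).
  by field.
Qed.

(** [l2proj] is the zero function when no projection exists. *)
Lemma pwpoly_l2proj k (f : R * R -> R) : pwpoly k U T (l2proj k U T f).
Proof.
rewrite /l2proj; set P := [set q | _].
have [/(xgetPex (fun=> 0))[]//|nP] := pselect (exists q, P q).
rewrite xgetPN; last by move=> q Pq; apply: nP; exists q.
split; first exact: measurable_cst.
move=> i; exists (fun _ _ => 0) => x _; rewrite /poly2 big1// => j _.
by rewrite big1// => l _; rewrite !mul0r.
Qed.

End MeshWeights.

(** * The broken energy product and the load *)

Section BrokenEnergy.
Variable R : realType.
Local Notation plane := (measurableTypeR R * measurableTypeR R)%type.
Variables (m : nat) (U : set (R * R)) (N : nat) (T : 'I_N -> 'I_3 -> R * R).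
Hypotheses (oU : open U) (trT : triangulation U T).
Hypothesis subT : forall i, (tri (T i))° `<=` U.
Implicit Types u v w : R * R -> R.

Local Notation H := (broken_sobolev U T m).

Let mU : @measurable _ plane U.
Proof. exact: open_measurable2. Qed.

Lemma sub_lincomb v w : v - w = lincomb (-1) w v.
Proof. by apply/funext => x; rewrite /lincomb mulN1r addrC. Qed.

Lemma tensorL2_Dpw v : H v -> tensorL2 U (Dpw T v : tensor R m).
Proof. by move=> hv al; exact: inL2_Dpw. Qed.

Lemma broken_sobolevB v w : H v -> H w -> H (v - w).
Proof. by move=> hv hw; rewrite sub_lincomb; exact: broken_sobolev_lincomb. Qed.

Lemma tdot_DpwB (G : tensor R m) v w : tensorL2 U G -> H v -> H w ->
  tdot U G (Dpw T (v - w)) = tdot U G (Dpw T v) - tdot U G (Dpw T w).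
Proof.
move=> LG hv hw; have Lv := tensorL2_Dpw hv; have Lw := tensorL2_Dpw hw.
rewrite sub_lincomb tdotC (@tdot_ae _ _ _ _ _ (tlincomb (-1) (Dpw T w) (Dpw T v)))//.
- by rewrite tdot_lincombl// mulN1r addrC (tdotC _ G) (tdotC _ (Dpw T w) G).
- by apply: tensorL2_Dpw; exact: broken_sobolev_lincomb.
- exact: tensorL2_lincomb.
- by move=> al; exact: Dpw_lincomb.
Qed.

Lemma apwC v w : apw m U T v w = apw m U T w v.
Proof. exact: tdotC. Qed.

Lemma apwBr v w z : H v -> H w -> H z ->
  apw m U T z (v - w) = apw m U T z v - apw m U T z w.
Proof. by move=> hv hw hz; apply: tdot_DpwB => //; exact: tensorL2_Dpw. Qed.

Lemma apwBl v w z : H v -> H w -> H z ->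
  apw m U T (v - w) z = apw m U T v z - apw m U T w z.
Proof. by move=> hv hw hz; rewrite (apwC _ z) (apwBr hv hw hz) (apwC z v) (apwC z w). Qed.

Lemma apw_ae v v' w : inL2 U v -> inL2 U v' -> ae_eq_on U v v' ->
  apw m U T v w = apw m U T v' w.
Proof.
move=> Lv Lv' vv; have E : Dpw T v = Dpw T v' :> tensor R m.
  by apply/funext => al; exact: (Dpw_ae oU subT al Lv Lv' vv).
by rewrite /apw E.
Qed.

Lemma energy_pw_sqr v : energy_pw m U T v ^+ 2 = apw m U T v v.
Proof. by rewrite sqr_sqrtr//; exact: tdot_ge0. Qed.

Lemma apw_cauchy_schwarz v w : H v -> H w ->
  `|apw m U T v w| <= energy_pw m U T v * energy_pw m U T w.
Proof. by move=> hv hw; apply: tdot_cauchy_schwarz => //; exact: tensorL2_Dpw. Qed.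

Lemma tensorL2_Dm v : sobolev m U v -> tensorL2 U (Dm U v : tensor R m).
Proof.
move=> [_ hv] al; have := hv al; rewrite size_tuple leqnn => /(_ isT) h.
by have [] := wderivP h.
Qed.

Lemma tdot_Dm_Dpw (G : tensor R m) v : tensorL2 U G -> sobolev m U v ->
  tdot U G (Dm U v) = tdot U G (Dpw T v).
Proof.
move=> LG sv; rewrite (tdotC _ G) (tdotC _ G (Dpw T v)); apply: tdot_ae => //.
- exact: tensorL2_Dm.
- by apply: tensorL2_Dpw; exact: sobolev_broken.
- by move=> al; apply: ae_eq_on_sym; exact: Dpw_Dm.
Qed.

Lemma afun_apw v w : sobolev m U v -> sobolev m U w -> afun m U v w = apw m U T v w.
Proof.
move=> sv sw; have Lw : tensorL2 U (Dpw T w : tensor R m).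
  by apply: tensorL2_Dpw; exact: sobolev_broken.
rewrite /afun /apw (tdot_Dm_Dpw (tensorL2_Dm sv) sw) tdotC (tdot_Dm_Dpw Lw sv).
exact: tdotC.
Qed.

Variables (G : tensor R m) (g : R * R -> R).
Hypotheses (LG : tensorL2 U G) (Lg : inL2 U g).

Definition load v : R := tdot U G (Dpw T v) + int2 U (fun x => g x * v x).

Lemma loadB v w : H v -> H w -> load (v - w) = load v - load w.
Proof.
move=> hv hw; have [Lv _] := hv; have [Lw _] := hw.
have E : int2 U (fun x => g x * (v - w) x) =
    -1 * int2 U (fun x => g x * w x) + int2 U (fun x => g x * v x).
  rewrite -(int2_lincomb _ mU (inL2_mul mU Lg Lw) (inL2_mul mU Lg Lv)).
  by apply: eq_int2 => x _; rewrite /lincomb !fctE mulN1r mulrBr addrC.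
rewrite /load (tdot_DpwB LG hv hw) E.
move: (tdot U G (Dpw T v)) (tdot U G (Dpw T w)) => a b.
move: (int2 U (fun x => g x * v x)) (int2 U (fun x => g x * w x)) => c d.
by ring.
Qed.

(** [D^m r] is orthogonal to piecewise constants, in particular to the projection
    of [G]. *)
Lemma load_oscillation (bU : bounded_set U) (kappa : R) r : H r ->
  (forall Q : tensor R m, (forall al, pwpoly 0 U T (Q al)) -> tdot U (Dpw T r) Q = 0) ->
  l2norm U (fun x => meshsize T x ^- m * r x) <= kappa * energy_pw m U T r ->
  load r <= (tnorm U (fun al x => G al x - tproj 0 U T G al x) +
             kappa * l2norm U (fun x => meshsize T x ^+ m * g x)) * energy_pw m U T r.
Proof.
move=> hr r0 rk; have [Lr _] := hr.
have pP al : pwpoly 0 U T (tproj 0 U T G al) by exact: pwpoly_l2proj.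
have LP : tensorL2 U (tproj 0 U T G) by move=> al; exact: pwpoly_inL2 (pP al).
have -> : (fun al x => G al x - tproj 0 U T G al x) = tlincomb (-1) (tproj 0 U T G) G.
  by apply/funext => al; apply/funext => x; rewrite /tlincomb /lincomb mulN1r addrC.
have LGP := tensorL2_lincomb (-1) LP LG.
have GE : tdot U G (Dpw T r) = tdot U (tlincomb (-1) (tproj 0 U T G) G) (Dpw T r).
  rewrite (tdot_lincombl mU _ LP LG (tensorL2_Dpw hr)).
  by rewrite (tdotC _ (tproj 0 U T G)) r0// mulr0 add0r.
rewrite /load GE mulrDl; apply: lerD.
  exact: le_trans (ler_norm _) (tdot_cauchy_schwarz mU LGP (tensorL2_Dpw hr)).
apply: le_trans (int2_weighted_cauchy_schwarz oU trT m Lg Lr) _.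
by rewrite mulrAC [X in _ <= X]mulrC ler_wpM2l// sqrtr_ge0.
Qed.

End BrokenEnergy.

Lemma fsum_pointB (R : realType) (A : set (R * R)) (beta v w : R * R -> R) : finite_set A ->
  \sum_(a \in A) beta a * (v - w) a =
  \sum_(a \in A) beta a * v a - \sum_(a \in A) beta a * w a.
Proof.
move=> fA; rewrite !fsbig_finite// -sumrB; apply: eq_bigr => a _.
by rewrite !fctE mulrBr.
Qed.

(** * The two error identities *)

Section AbstractErrorIdentities.
Variables (R : realType) (X : zmodType) (H V W : X -> Prop).
Variables (B : X -> X -> R) (L pts : X -> R) (I : X -> X).
Hypotheses (VH : forall v, V v -> H v) (WH : forall w, W w -> H w).
Hypothesis HB : forall v w, H v -> H w -> H (v - w).
Hypothesis VB : forall v w, V v -> V w -> V (v - w).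
Hypothesis WB : forall v w, W v -> W w -> W (v - w).
Hypothesis BC : forall v w, B v w = B w v.
Hypothesis Bl : forall v w z, H v -> H w -> H z -> B (v - w) z = B v z - B w z.
Hypothesis LB : forall v w, H v -> H w -> L (v - w) = L v - L w.
Hypothesis IW : forall v, V v -> W (I v).
Hypothesis Iorth : forall v w, V v -> W w -> B (v - I v) w = 0.
Hypothesis ptsI : forall v, V v -> pts (I v) = pts v.
(* The names follow the application: [V] and [W] are the conforming and the
   discrete space in the broken space [H], [I] the interpolation, [L + pts] the
   load with point forces, [Ju] the smoothed discrete solution. *)
Variables u unc Ju : X.
Hypotheses (Vu : V u) (Wunc : W unc) (VJ : V Ju).
Hypothesis Jorth : forall w, W w -> B (unc - Ju) w = 0.
Hypothesis u_sol : forall v, V v -> B u v = L v + pts v.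
Hypothesis unc_sol : forall w, W w -> B unc w = L w + pts w.

Let Br v w z : H v -> H w -> H z -> B z (v - w) = B z v - B z w.
Proof. by move=> hv hw hz; rewrite BC Bl// (BC v) (BC w). Qed.

Let IE v w : V v -> W w -> B v w = B (I v) w.
Proof.
move=> hv hw; apply/eqP; rewrite -subr_eq0 -Bl; [|exact: VH|exact/WH/IW|exact: WH].
by rewrite Iorth.
Qed.

(** Expand [B e e = B u e - B Ju e], use the continuous equation for the first term
    and [B Ju e = B unc e - B (unc - Ju) e] with the discrete equation for the
    second one. *)
Lemma conforming_error_identity (e := u - Ju) (r := e - I e) :
  B e e = B r r + B (I u - unc) (I u - unc) /\ B e e = L r + B (unc - Ju) r.
Proof.
have Ve : V e by exact: VB.
have He := VH Ve; have WIe := IW Ve; have HIe := WH WIe; have Hr : H r by exact: HB.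
have Hu := VH Vu; have HJ := VH VJ; have Hunc := WH Wunc; have HIu := WH (IW Vu).
have Ww : W (I u - unc) by apply: WB => //; exact: IW.
have Hw := WH Ww; have Hd : H (unc - Ju) by exact: HB.
have rI : B r (I e) = 0 by exact: Iorth.
have eqw : B (I e) (I e) = B (I u - unc) (I u - unc).
  (* [I e] and [I u - unc] agree against all of [W]. *)
  have h p : W p -> B (I e) p = B (I u - unc) p.
    move=> Wp; have Hp := WH Wp; have := Jorth Wp.
    by rewrite -IE// /e !Bl// [B u p]IE// => /eqP; rewrite subr_eq0 => /eqP ->.
  by rewrite h// BC h.
split.
  have E1 : B e e = B r e + B (I e) e by rewrite /r (Bl He HIe He) subrK.
  have E2 : B r r = B r e by rewrite {2}/r (Br He HIe Hr) rI subr0.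
  have E3 : B (I e) e = B (I e) (I e) by rewrite BC (IE Ve WIe).
  by rewrite E1 E2 E3 eqw.
have E1 : B e e = L e + pts e - B Ju e by rewrite {1}/e Bl// u_sol.
have E2 : B (unc - Ju) r = B unc e - B Ju e.
  by rewrite /r (Br He HIe Hd) (Jorth WIe) subr0 (Bl Hunc HJ He).
have E3 : B unc e = L (I e) + pts e by rewrite BC (IE Ve Wunc) BC (unc_sol WIe) (ptsI Ve).
by rewrite E1 E2 E3 /r LB//; ring.
Qed.

(** Here [B unc unc - B u Ju] is the extended load at [unc - Ju], by the two
    equations. *)
Lemma nonconforming_error_identity (z := u - unc) (r := u - I u) (w := I u - unc) :
  B z z = B r r + B w w /\
  B z z = L r + (B unc unc - B u Ju) - B r (unc - Ju).
Proof.
have WIu := IW Vu; have HIu := WH WIu; have Hr : H r by apply: HB => //; exact: VH.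
have Hu := VH Vu; have HJ := VH VJ; have Hunc := WH Wunc.
have Ww : W (unc - I u) by exact: WB.
have Hw := WH Ww; have Hd : H (unc - Ju) by exact: HB.
have zE : z = r - (unc - I u) by rewrite /z /r opprB addrA addrNK.
have Hz : H z by exact: HB.
have rI : B r (unc - I u) = 0 by exact: Iorth.
split.
  have -> : B w w = B (unc - I u) (unc - I u).
    by have Hw' : H w by [exact: HB]; rewrite /w !Bl// !Br//; ring.
  rewrite {1}zE (Bl Hr Hw Hz) zE (Br Hr Hw Hr) (Br Hr Hw Hw) rI (BC _ r) rI.
  by rewrite subr0 sub0r opprK.
have E1 : B z z = B u u - B u unc - (B u unc - B unc unc).
  by rewrite {1}/z (Bl Hu Hunc Hz) (Br Hu Hunc Hu) (Br Hu Hunc Hunc) (BC unc u).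
have E2 : B u unc = L (I u) + pts u by rewrite IE// BC unc_sol// ptsI.
have E3 : B r (unc - Ju) = B u unc - B u Ju.
  by rewrite /r (Bl Hu HIu Hd) (BC (I u)) Jorth// subr0 (Br Hunc HJ Hu).
by rewrite E1 E3 (u_sol Vu) /r LB// {1}E2; ring.
Qed.

End AbstractErrorIdentities.

(** The hypotheses give [r ^+ 2 + w ^+ 2 <= (s + t) * r + c]; then use that the
    square of [s + t - r] is nonnegative. *)
Lemma square_completion (R : realDomainType) (ee ww rr w r l c b s t : R) :
  ee = rr + ww -> ee = l + c + b -> w ^+ 2 = ww -> r ^+ 2 = rr ->
  l <= s * r -> b <= t * r -> ee + w ^+ 2 <= (s + t) ^+ 2 + 2 * c.
Proof.
move=> E1 E2 wE rE ls bt; have := sqr_ge0 (s + t - r).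
by rewrite wE; nra.
Qed.

Theorem theorem6p1 (R : realType) (m : nat)
  (Om : set (R * R)) (hOm : polygonal_lipschitz_domain Om)
  (N : nat) (T : 'I_N -> 'I_3 -> R * R) (hT : triangulation Om T)
  (sigma : R) (hsigma : shape_regular sigma T)
  (Vnc : set (R * R -> R))
  (hVnc_sub : Vnc `<=` pwpoly m Om T)
  (hVnc_lin : linear_subspace Vnc)
  (hVnc_nontriv : exists2 v, Vnc v & ~ ae_eq_on Om v (fun=> 0))
  (hVnc_norm : is_norm_on Om Vnc (energy_pw m Om T))
  (Inc : (R * R -> R) -> (R * R -> R)) (kappa : R) (hkappa : 0 < kappa)
  (hInc : forall v, sobolev0 m Om v -> Vnc (Inc v))
  (hInc_orth : forall v w, sobolev0 m Om v -> pwpoly m Om T w ->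
     apw m Om T (v - Inc v) w = 0)
  (hInc_kappa : forall v, sobolev0 m Om v ->
     l2norm Om (fun x => (meshsize T x) ^- m * (v x - Inc v x))
       <= kappa * energy_pw m Om T (v - Inc v))
  (hInc_mean : forall v (Q : tensor R m), sobolev0 m Om v ->
     (forall al, pwpoly 0 Om T (Q al)) -> tdot Om (Dpw T (v - Inc v)) Q = 0)
  (J : (R * R -> R) -> (R * R -> R)) (LambdaJ : R)
  (hJ : forall vnc, Vnc vnc -> sobolev0 m Om (J vnc))
  (hJ_lin : forall a vnc wnc, Vnc vnc -> Vnc wnc ->
     ae_eq_on Om (J (lincomb a vnc wnc)) (lincomb a (J vnc) (J wnc)))
  (hJ_inv : forall vnc, Vnc vnc -> ae_eq_on Om (Inc (J vnc)) vnc)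
  (hJ_best : forall vnc v, Vnc vnc -> sobolev0 m Om v ->
     energy_pw m Om T (vnc - J vnc) <= LambdaJ * energy_pw m Om T (vnc - v))
  (hJ_orth : forall vnc p, Vnc vnc -> pwpoly m Om T p ->
     int2 Om (fun x => (vnc x - J vnc x) * p x) = 0)
  (G : tensor R m) (hG : forall al, inL2 Om (G al))
  (g : R * R -> R) (hg : inL2 Om g)
  (A : set (R * R)) (hA_fin : finite_set A)
  (hA_vertex : A `<=` interior_vertex Om T)
  (beta : R * R -> R)
  (hA_m1 : m = 1%N -> A = set0)
  (hA_m2 : A !=set0 -> (2 <= m)%N)
  (hA_cont : A !=set0 -> forall vnc z, Vnc vnc -> interior_vertex Om T z ->
     {for z, continuous vnc})
  (hA_Inc : A !=set0 -> forall v a, sobolev0 m Om v -> A a -> Inc v a = v a)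
  (F : (R * R -> R) -> R)
  (hF_dual : in_dual (sobolev0 m Om) (energy m Om) F)
  (hF : forall v, sobolev0 m Om v ->
     F v = tdot Om G (Dm Om v) + int2 Om (fun x => g x * v x)
           + \sum_(a \in A) beta a * v a)
  (Fhat : (R * R -> R) -> R)
  (hFhat : forall v, sumspace (sobolev0 m Om) Vnc v ->
     Fhat v = tdot Om G (Dpw T v) + int2 Om (fun x => g x * v x)
              + \sum_(a \in A) beta a * v a)
  (u : R * R -> R) (hu : sobolev0 m Om u)
  (hu_sol : forall v, sobolev0 m Om v -> afun m Om u v = F v)
  (unc : R * R -> R) (hunc : Vnc unc)
  (hunc_sol : forall vnc, Vnc vnc -> apw m Om T unc vnc = Fhat vnc) :
  let est := tnorm Om (fun al x => G al x - tproj 0 Om T G al x)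
             + kappa * l2norm Om (fun x => (meshsize T x) ^+ m * g x)
             + energy_pw m Om T (unc - J unc) in
  (energy m Om (u - J unc)) ^+ 2 + (energy_pw m Om T (Inc u - unc)) ^+ 2
    <= est ^+ 2
  /\
  (energy_pw m Om T (u - unc)) ^+ 2 + (energy_pw m Om T (Inc u - unc)) ^+ 2
    <= est ^+ 2 + 2 * Fhat (unc - J unc).
Proof.
move=> est.
have [oU _ _ bU _] := hOm.
have subT i : (tri (T i))° `<=` Om by exact: tri_sub_domain.
pose H := broken_sobolev Om T m; pose V := sobolev0 m Om.
pose pts (v : R * R -> R) := \sum_(a \in A) beta a * v a.
pose d := unc - J unc.
have LG : tensorL2 Om G by [].
have VH v : V v -> H v by move=> [sv _ _]; exact: sobolev_broken.
have WH v : Vnc v -> H v by move=> /hVnc_sub pv; exact: (pwpoly_broken oU bU hT subT m pv).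
have HB v w : H v -> H w -> H (v - w) by exact: broken_sobolevB.
have VB v w : V v -> V w -> V (v - w).
  by move=> hv hw; rewrite sub_lincomb; exact: sobolev0_lincomb.
have WB v w : Vnc v -> Vnc w -> Vnc (v - w).
  by move=> hv hw; rewrite sub_lincomb; exact: hVnc_lin.2.
have V0 : V 0 by rewrite -(subrr u); exact: VB.
have VJ : V (J unc) by exact: hJ.
have afunE v w : V v -> V w -> apw m Om T v w = afun m Om v w.
  by move=> [sv _ _] [sw _ _]; rewrite (afun_apw oU hT subT sv sw).
have u_sol v : V v -> apw m Om T u v = load Om T G g v + pts v.
  move=> hv; have [sv _ _] := hv.
  by rewrite afunE// hu_sol// hF// (tdot_Dm_Dpw oU hT subT LG sv).
have FhatE v : sumspace V Vnc v -> Fhat v = load Om T G g v + pts v.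
  by move=> hv; rewrite hFhat.
have unc_sol w : Vnc w -> apw m Om T unc w = load Om T G g w + pts w.
  by move=> hw; rewrite hunc_sol// FhatE//; exists 0, w; split=> //; rewrite add0r.
have LB v w : H v -> H w ->
    load Om T G g (v - w) = load Om T G g v - load Om T G g w.
  exact: (loadB oU subT LG hg).
have Bl v w z : H v -> H w -> H z ->
    apw m Om T (v - w) z = apw m Om T v z - apw m Om T w z.
  exact: (apwBl oU subT).
have BC v w : apw m Om T v w = apw m Om T w v by exact: apwC.
have Iorth v w : V v -> Vnc w -> apw m Om T (v - Inc v) w = 0.
  by move=> hv /hVnc_sub hw; exact: hInc_orth.
have ptsI v : V v -> pts (Inc v) = pts v.
  by move=> hv; apply: eq_fsbigr => a /set_mem Aa; rewrite hA_Inc//; exists a.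
have Hd : H d by apply: HB; [exact: WH|exact: VH].
have Jorth w : Vnc w -> apw m Om T d w = 0.
  move=> hw; have HJ := VH _ VJ; have Hunc := WH _ hunc; have Hw := WH _ hw.
  have HIJ := WH _ (hInc _ VJ).
  have := Iorth _ _ VJ hw; rewrite (Bl _ _ _ HJ HIJ Hw) (Bl _ _ _ Hunc HJ Hw).
  rewrite (apw_ae m oU subT w HIJ.1 Hunc.1 (hJ_inv _ hunc)) => /eqP.
  by rewrite subr_eq0 => /eqP ->; rewrite subrr.
have Fhatd : Fhat d = apw m Om T unc unc - apw m Om T u (J unc).
  have -> : Fhat d = load Om T G g d + pts d.
    apply: FhatE; exists (0 - J unc), unc; split=> //; first exact: VB.
    by rewrite sub0r addrC.
  have ptsd : pts d = pts unc - pts (J unc) by exact: fsum_pointB.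
  rewrite (unc_sol _ hunc) (u_sol _ VJ) (LB _ _ (WH _ hunc) (VH _ VJ)) ptsd.
  move: (load _ _ _ _ unc) (load _ _ _ _ (J unc)) (pts unc) (pts (J unc)) => l1 l2 p1 p2.
  by ring.
have osc v : V v -> load Om T G g (v - Inc v) <=
    (tnorm Om (fun al x => G al x - tproj 0 Om T G al x)
     + kappa * l2norm Om (fun x => (meshsize T x) ^+ m * g x)) *
    energy_pw m Om T (v - Inc v).
  move=> hv; apply: (load_oscillation oU hT subT LG hg bU).
  - by apply: HB; [exact: VH|exact/WH/hInc].
  - by move=> Q hQ; exact: hInc_mean.
  - exact: hInc_kappa.
have enE v : energy_pw m Om T v ^+ 2 = apw m Om T v v by exact: energy_pw_sqr.
split.
- have Ve : V (u - J unc) by exact: VB.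
  have [E1 E2] := conforming_error_identity VH WH HB VB WB BC Bl LB hInc Iorth ptsI
    hu hunc VJ Jorth u_sol unc_sol.
  have enJ : energy m Om (u - J unc) ^+ 2 = apw m Om T (u - J unc) (u - J unc).
    by rewrite (afunE _ _ Ve Ve) sqr_sqrtr//; exact: tdot_ge0.
  have Hr : H (u - J unc - Inc (u - J unc)) by apply: HB; [exact: VH|exact/WH/hInc].
  have csr := le_trans (ler_norm _) (apw_cauchy_schwarz oU Hd Hr).
  have E2' := etrans E2 (congr1 (fun t => t + _) (esym (addr0 _))).
  have := square_completion E1 E2' (enE _) (enE _) (osc _ Ve) csr.
  by rewrite mulr0 addr0 -enJ.
- have [E1 E2] := nonconforming_error_identity VH WH HB WB BC Bl LB hInc Iorth ptsI
    hu hunc VJ Jorth u_sol unc_sol.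
  have Hr : H (u - Inc u) by apply: HB; [exact: VH|exact/WH/hInc].
  have csr : - apw m Om T (u - Inc u) d <= energy_pw m Om T d * energy_pw m Om T (u - Inc u).
    apply: le_trans (apw_cauchy_schwarz oU Hd Hr).
    by rewrite (BC (u - Inc u) d) -normrN ler_norm.
  have := square_completion E1 E2 (enE _) (enE _) (osc _ hu) csr.
  by rewrite -(enE (u - unc)) -{1}Fhatd.
Qed.
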